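(* Let $N\ge 3$, let $a\in\mathbb{R}$ satisfy $N-2+a>0$, let $E=[0,\infty)\times[0,\infty)$, and let $F=(f_1,f_2):(\mathbb{R}^N\setminus\{0\})\times E\to E$ be an admissible pair of nonlinearities (as defined in the context). Assume that: (i) for every $x\in\mathbb{R}^N\setminus\{0\}$ and every $Y\in(0,\infty)\times(0,\infty)$ the map $$\mu\longmapsto \mu^{\frac{N+2-a}{N-2+a}}\,F\big(\mu^{\frac{2}{N-2+a}}x,\ \mu^{-1}Y\big)\quad\text{is strictly increasing (component-wise) on } [1,\infty);$$ (ii) there exist $d>0$, $b>a-2$ and, for $i=1,2$, $P^{i}>(1,1)$ with $|P^{i}|<p_S(a,b):=\frac{N+2+2b-a}{N-2+a}$ such that for all sufficiently large $R>1$ and $i=1,2$, $$f_i(x,Y)\ge d\,|x|^{b}\,Y^{P^{i}}\quad\text{for all }(x,Y)\in B_R^c(0)\times E.$$ Then the system $\operatorname{div}(|x|^aDU)+F(x,U)=0$ in $\mathbb{R}^N$ has no positive entire solution.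
   Context: $D$ denotes the gradient, and $B_R^c(0)=\mathbb{R}^N\setminus B_R(0)$ is the complement of the open ball of radius $R$ centered at the origin. For $U=(u_1,u_2)$, the vector equation $\operatorname{div}(|x|^aDU)+F(x,U)=0$ means the system $\operatorname{div}(|x|^aDu_i)+f_i(x,u_1,u_2)=0$ for $i=1,2$. Relations such as $U>0$, $U\le V$, $P>(1,1)$ between vectors are understood component-wise. For $P=(p_1,p_2)$ and $Y=(y_1,y_2)\in E$, write $|P|=p_1+p_2$ and $Y^P=y_1^{p_1}y_2^{p_2}$. The pair $F=(f_1,f_2)$, $f_i:(\mathbb{R}^N\setminus\{0\})\times E\to[0,\infty)$, is called admissible if $f_1,f_2$ are smooth and for $i=1,2$: (I) $f_i(x,0)=0$ and $f_i(x,U)>0$ for all $x\ne0$ and $U>0$; (II') (cooperative property) for $x\neq0$ and $U,V\in E$, if $U\le V$ and $u_i=v_i$ then $f_i(x,U)\le f_i(x,V)$; (III) there is $b_0>a-2>-N$ such that for each compact $\omega\subset E$ there exists $L>0$ with $|f_i(x,U)-f_i(x,V)|\le L|x|^{b_0}|U-V|$ for all $x\ne0$ and $U,V\in\omega$. A positive entire solution is a pair $U=(u_1,u_2)$ with $u_1,u_2:\mathbb{R}^N\to(0,\infty)$ of class $C^2(\mathbb{R}^N\setminus\{0\})\cap C(\mathbb{R}^N)$ satisfying the system pointwise everywhere in $\mathbb{R}^N\setminus\{0\}$. *)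

(* Defs.v *)
From mathcomp Require Import all_boot all_order all_algebra.
From mathcomp Require Import all_classical all_reals all_analysis.

Set Implicit Arguments.
Unset Strict Implicit.
Unset Printing Implicit Defensive.

Import Order.TTheory GRing.Theory Num.Theory.
Import numFieldNormedType.Exports.

Local Open Scope classical_set_scope.
Local Open Scope ring_scope.

(* The library norm on 'rV[R]_n is the sup norm, hence a separate Euclidean
   norm; both induce the same topology. *)
Definition enorm (R : realType) (n : nat) (x : 'rV[R]_n) : R :=
  Num.sqrt (\sum_(i < n) x 0 i ^+ 2).

Definition eball (R : realType) (n : nat) (r : R) : set 'rV[R]_n :=
  [set x | enorm x < r].

Definition orthant (R : realType) : set 'rV[R]_2 :=
  [set Y | forall j, 0 <= Y 0 j].

Definition open_orthant (R : realType) : set 'rV[R]_2 :=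
  [set Y | forall j, 0 < Y 0 j].

(* C^k on an open set O of a finite-dimensional space V: all iterated
   directional derivatives of order at most k exist and are continuous on O. *)
Fixpoint Ck_on (R : realType) (V : normedModType R) (k : nat) (O : set V)
    (g : V -> R) : Prop :=
  (forall x, O x -> {for x, continuous g}) /\
  (if k is k'.+1 then
     forall v : V, (forall x, O x -> derivable g x v) /\ Ck_on k' O ('D_v g)
   else True).

Definition grad (R : realType) (n : nat) (u : 'rV[R]_n -> R) (x : 'rV[R]_n)
    : 'rV[R]_n :=
  \row_(i < n) 'D_(delta_mx 0 i) u x.

Definition divergence (R : realType) (n : nat) (W : 'rV[R]_n -> 'rV[R]_n)
    (x : 'rV[R]_n) : R :=
  \sum_(i < n) 'D_(delta_mx 0 i) (fun y => W y 0 i) x.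

(* y_1^{p_1} y_2^{p_2} *)
Definition mpow (R : realType) (Y P : 'rV[R]_2) : R :=
  \prod_(j < 2) (Y 0 j `^ P 0 j).

(* Only the values of F at (x, Y) with x != 0 and Y in the closed orthant are
   meaningful.  Smoothness means continuity up to the boundary of the orthant
   and C^oo where both components of Y are positive: requiring C^oo up to the
   boundary would exclude the powers Y^P with non-integer exponents. *)
Record admissible (R : realType) (N : nat) (a : R)
    (F : 'rV[R]_N -> 'rV[R]_2 -> 'rV[R]_2) : Prop := Admissible {
  adm_ge0 : forall (i : 'I_2) (x : 'rV[R]_N) (Y : 'rV[R]_2), x != 0 -> orthant Y -> 0 <= F x Y 0 i;
  adm_cont : forall i : 'I_2,
    {within [set z : 'rV[R]_N * 'rV[R]_2 | z.1 != 0 /\ orthant z.2],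
      continuous (fun z => F z.1 z.2 0 i)};
  adm_smooth : forall (i : 'I_2) (k : nat),
    Ck_on k [set z : 'rV[R]_N * 'rV[R]_2 | z.1 != 0 /\ open_orthant z.2]
      (fun z => F z.1 z.2 0 i);
  adm_zero : forall (i : 'I_2) (x : 'rV[R]_N), x != 0 -> F x 0 0 i = 0;
  adm_pos : forall (i : 'I_2) (x : 'rV[R]_N) (Y : 'rV[R]_2), x != 0 -> open_orthant Y -> 0 < F x Y 0 i;
  adm_coop : forall (i : 'I_2) (x : 'rV[R]_N) (Y Z : 'rV[R]_2), x != 0 -> orthant Y -> orthant Z ->
    (forall j, Y 0 j <= Z 0 j) -> Y 0 i = Z 0 i -> F x Y 0 i <= F x Z 0 i;
  adm_lip : forall i : 'I_2, exists b0 : R,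
    [/\ b0 > a - 2, a - 2 > - N%:R &
      forall K : set 'rV[R]_2, compact K -> K `<=` @orthant R ->
        exists L : R, 0 < L /\
          forall (x : 'rV[R]_N) (Y Z : 'rV[R]_2), x != 0 -> K Y -> K Z ->
            `|F x Y 0 i - F x Z 0 i| <= L * enorm x `^ b0 * enorm (Y - Z)]
}.

Record positive_entire_solution (R : realType) (N : nat) (a : R)
    (F : 'rV[R]_N -> 'rV[R]_2 -> 'rV[R]_2) (U : 'rV[R]_N -> 'rV[R]_2)
    : Prop := PositiveEntireSolution {
  sol_pos : forall (i : 'I_2) (x : 'rV[R]_N), 0 < U x 0 i;
  sol_cont : forall i : 'I_2, continuous (fun x => U x 0 i);
  sol_C2 : forall i : 'I_2,
    Ck_on 2%N [set x : 'rV[R]_N | x != 0] (fun x => U x 0 i);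
  sol_eq : forall (i : 'I_2) (x : 'rV[R]_N), x != 0 ->
    divergence (fun y => (enorm y `^ a) *: grad (fun z => U z 0 i) y) x
      + F x (U x) 0 i = 0
}.

(* Main.v *)
From HB Require Import structures.
Require Import Defs.
From mathcomp Require Import all_boot all_order all_algebra.
From mathcomp Require Import all_classical all_reals all_analysis.
From mathcomp Require Import ring lra.

Set Implicit Arguments.
Unset Strict Implicit.
Unset Printing Implicit Defensive.

Import Order.TTheory GRing.Theory Num.Theory.
Import numFieldNormedType.Exports.

Local Open Scope classical_set_scope.
Local Open Scope ring_scope.

(** Put del = N - 2 + a.  In the logarithmic coordinates x = e^t th, |th| = 1, the
    functions w_i(t, th) = e^(del t / 2) u_i(e^t th) solve, on the cylinder R x S
    over the unit sphere S,
<<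
      d^2 w_i / dt^2 + Lap_S w_i - (del / 2)^2 w_i + g_i(t, th, w) = 0,
      g_i(t, th, Y) = e^((2 - a + del / 2) t) f_i(e^t th, e^(- del t / 2) Y).
>>
    Inversions in spheres about the origin have become the reflections
    t -> 2 tau - t, which leave the linear part invariant, and the monotonicity
    hypothesis on F says exactly that g increases with t.  Moving spheres for u is
    therefore moving planes for w ([cylinder_solution_nondecreasing]).  The
    differences z_i(t, th) = w_i(2 tau - t, th) - w_i(t, th) are nonnegative on
    t <= tau for every tau:

    - w decays as t -> -oo, because u is continuous at the origin, and the
      Lipschitz constant of g decays as well, because b0 > a - 2.  A negative
      minimum of z far to the left would contradict the equation
      ([mirror_ordered_far_left]); in particular z >= 0 for very negative tau.
    - If z >= 0 for some tau, then z > 0 for t < tau, as g is strictly increasing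
      ([mirror_ordered_strict]).  For slightly larger tau a negative minimum of z
      could thus lie only far to the left or in a narrow strip next to the mirror.
      On that strip, a concave weight makes the maximum principle hold
      ([strip_comparison]), so z >= 0 for these tau too
      ([mirror_ordered_open_right]).  The set of tau with z >= 0 is also closed,
      hence it is the whole line ([mirror_ordered_all]).

    So w is nondecreasing in t, and bounded below by some c > 0 on t >= 0.  As |P| is
    less than p_S(a, b), the growth hypothesis gives g_i >= d e^(sig t) Y^P with
    sig > 0 ([cylinder_nonlinearity_growth]); hence w_i satisfies
    d^2 w_i / dt^2 + Lap_S w_i <= - 2 w_i for large t.  No positive function does so
    on a strip of width pi, as one sees by touching w_i from below with a multiple
    of sin (t - k) ([cylinder_no_solution]).

    The Laplacian of the sphere is the sum of the second derivatives along the
    rotations of the coordinate planes.  Each use of the maximum principle then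
    reduces to the fact that the second derivative of a function of one variable is
    nonnegative at a minimum.  The equation for w
    ([emden_fowler_equation]) comes from the chain rule along rotations and
    dilations. *)

(** * Differentiability from continuous partial derivatives *)

Lemma cvg_sum (R : realType) (I : finType) (T : Type) (F : set_system T)
    {FF : Filter F} (f : I -> T -> R) (l : I -> R) :
  (forall i, f i x @[x --> F] --> l i) ->
  \sum_i f i x @[x --> F] --> \sum_i l i.
Proof. by move=> fl; apply: cvg_big => //; exact: add_continuous. Qed.

(** The mean value theorem for g - l id, on the segment from 0 to h for either sign
    of h. *)
Lemma mvt_affine_bound (R : realType) (g dg : R -> R) (h l e : R) :
  (forall s : R, `|s| <= `|h| -> is_derive s 1 g (dg s)) ->
  (forall s, `|s| <= `|h| -> `|dg s - l| <= e) ->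
  `|g h - g 0 - h * l| <= e * `|h|.
Proof.
move=> gd bd.
have cg s : `|s| <= `|h| -> {for s, continuous g}.
  move=> sh; apply/differentiable_continuous/derivable1_diffP.
  by have [] := gd s sh.
have [h0|h0] := leP 0 h.
- have nh s : s \in `[0, h]%R -> `|s| <= `|h|.
    by rewrite in_itv/= => /andP[s0 sh]; rewrite !ger0_norm.
  have [||c ch ->] := @MVT_segment R g dg 0 h h0.
  + by move=> s sh; apply/gd/nh; exact: subset_itv_oo_cc sh.
  + by apply: continuous_in_subspaceT => s /set_mem /= sh; apply/cg/nh.
  rewrite subr0 mulrC -mulrBr normrM mulrC.
  by apply: ler_wpM2r => //; exact/bd/nh.
- have nh s : s \in `[h, 0]%R -> `|s| <= `|h|.
    by rewrite in_itv/= => /andP[s0 sh]; rewrite !ler0_norm ?lerN2 // ltW.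
  have [||c ch E] := @MVT_segment R g dg h 0 (ltW h0).
  + by move=> s sh; apply/gd/nh; exact: subset_itv_oo_cc sh.
  + by apply: continuous_in_subspaceT => s /set_mem /= sh; apply/cg/nh.
  have -> : g h - g 0 - h * l = (dg c - l) * h by move: E; lra.
  rewrite normrM; apply: ler_wpM2r => //; exact/bd/nh.
Qed.

(** Reduces directional derivatives to derivatives of functions of one variable. *)
Lemma is_derive_line (R : realType) (V : normedModType R) (f : V -> R)
    (x v : V) (s : R) :
  derivable f (x + s *: v) v ->
  is_derive s 1 (fun r : R => f (x + r *: v)) ('D_v f (x + s *: v)).
Proof.
have E : (fun h : R => h^-1 *: (((fun r : R => f (x + r *: v)) \o shift s)
      (h *: (1 : R^o)) - f (x + s *: v)))
  = (fun h : R => h^-1 *: ((f \o shift (x + s *: v)) (h *: v)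
      - f (x + s *: v))).
  apply/funext => h /=; congr (_ *: (f _ - _)).
  by rewrite [h *: _]mulr1 scalerDl addrCA.
move=> fd; apply: DeriveDef; last by rewrite /derive /= E.
by rewrite /derivable /= E.
Qed.

(** The truncations of h interpolate between 0 and h, changing one coordinate at a
    time.  They stay in the sup-norm ball of h, hence so do the segments joining
    them. *)
Definition initial_part (R : realType) (n : nat) (h : 'rV[R]_n) (k : nat) :
  'rV[R]_n := \row_i (if (i < k)%N then h 0 i else 0).

Lemma initial_partS (R : realType) (n : nat) (h : 'rV[R]_n) (k : 'I_n) :
  initial_part h k.+1 = initial_part h k + h 0 k *: delta_mx 0 k.
Proof.
apply/rowP => i; rewrite !mxE eqxx/= ltnS leq_eqVlt -val_eqE/=.
by case: (ltngtP i k) => //= ik; rewrite ?mulr0 ?addr0// (val_inj ik) mulr1 add0r.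
Qed.

Lemma rV_coord_le_norm (R : realType) (n : nat) (h : 'rV[R]_n) i :
  `|h 0 i| <= `|h|.
Proof.
rewrite [leRHS]/Num.Def.normr/= mx_normrE.
exact: (le_bigmax _ (fun x : 'I_1 * 'I_n => `|h x.1 x.2|) (0, i)).
Qed.

Lemma rV_norm_le (R : realType) (n : nat) (h : 'rV[R]_n) e : 0 <= e ->
  (forall i, `|h 0 i| <= e) -> `|h| <= e.
Proof.
move=> e0 he; rewrite [leLHS]/Num.Def.normr/= mx_normrE.
by apply: bigmax_le => //= -[i j] _ /=; rewrite ord1.
Qed.

Lemma initial_part_line_norm (R : realType) (n : nat) (h : 'rV[R]_n)
    (k : 'I_n) (s : R) : `|s| <= `|h 0 k| ->
  `|initial_part h k + s *: delta_mx 0 k| <= `|h|.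
Proof.
move=> sh; apply: rV_norm_le => // i; rewrite !mxE eqxx/=.
case: (eqVneq i k) => [->|ik].
  by rewrite ltnn add0r mulr1 (le_trans sh)// rV_coord_le_norm.
by rewrite mulr0 addr0; case: ifP => _; rewrite ?normr0// rV_coord_le_norm.
Qed.

(** The increment f (x + h) - f x telescopes along the truncations of h; on the k-th
    segment only the k-th coordinate moves, and the one-dimensional estimate
    compares the increment with h_k times the partial derivative at x. *)
Lemma is_diff_partials (R : realType) (n : nat) (f : 'rV[R]_n -> R)
    (x : 'rV[R]_n) :
  (\forall y \near x, forall i, derivable f y (delta_mx 0 i)) ->
  (forall i, {for x, continuous ('D_(delta_mx 0 i) f)}) ->
  is_diff x f (fun h => \sum_(i < n) h 0 i * 'D_(delta_mx 0 i) f x).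
Proof.
move=> fd cf; pose L (h : 'rV[R]_n) := \sum_i h 0 i * 'D_(delta_mx 0 i) f x.
have linL : linear L.
  move=> a u v; rewrite -[RHS]/(a * L u + L v) /L mulr_sumr -big_split/=.
  by apply: eq_bigr => i _; rewrite !mxE mulrDl mulrA.
have [Lf LfE] : exists l : {linear 'rV[R]_n -> R}, l = L :> (_ -> _).
  pose lL : GRing.isLinear R 'rV[R]_n R _ L :=
    GRing.isLinear.Build R 'rV[R]_n R *%R L linL.
  pose l : {linear 'rV[R]_n -> R} := HB.pack L lL.
  by exists l.
have cL : continuous Lf.
  rewrite LfE => y; apply: (@cvg_sum R _ _ (nbhs y)) => i.
  apply: cvgM; last exact: cvg_cst.
  exact: coord_continuous.
have main : (f \o shift x : 'rV[R]_n -> R^o) =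
      cst (f x : R^o) + (Lf : 'rV[R]_n -> R^o) +o_ (0 : 'rV[R]_n) id.
  apply/eqaddoP => _/posnumP[e]; rewrite LfE.
  pose e' := e%:num / n.+1%:R.
  have e'0 : 0 < e' by rewrite divr_gt0.
  have near1 : \forall y \near x, forall i : 'I_n,
      derivable f y (delta_mx 0 i) /\
      `|'D_(delta_mx 0 i) f y - 'D_(delta_mx 0 i) f x| <= e'.
    have near2 : \forall y \near x, forall i : 'I_n,
        `|'D_(delta_mx 0 i) f y - 'D_(delta_mx 0 i) f x| <= e'.
      apply: (@filter_forall _ _ _ (nbhs x)) => i.
      by have /cvgrPdistC_le := cf i; apply.
    by apply: filterS2 fd near2 => y fdy ne i; split.
  have [r /= r0 rP] := (iffLR (nbhs_ballP _ _)) near1.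
  apply/nbhs_ballP; exists r => //= h /=; rewrite -ball_normE/= sub0r normrN => hr.
  have tele : f (h + x) - f x =
      \sum_(k < n) (f (x + initial_part h k.+1) - f (x + initial_part h k)).
    rewrite -(big_mkord xpredT (fun k => f (x + initial_part h k.+1)
      - f (x + initial_part h k))) telescope_sumr//.
    congr (f _ - f _); last first.
      by rewrite [initial_part _ _](_ : _ = 0) ?addr0//; apply/rowP => i; rewrite !mxE.
    by rewrite addrC; congr (_ + _); apply/rowP => i; rewrite !mxE ltn_ord.
  rewrite -[X in `|X|]/(f (h + x) - (f x + L h)) opprD addrA tele /L -sumrB.
  apply: (le_trans (ler_norm_sum _ _ _)).
  apply: (@le_trans _ _ (\sum_(k < n) e' * `|h|)); last first.
    rewrite sumr_const card_ord -mulrnAl ler_wpM2r//.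
    rewrite /e' -mulr_natr -mulrA ler_piMr// mulrC ler_pdivrMr// mul1r.
    by rewrite ler_nat.
  apply: ler_sum => k _.
  have inball s : `|s| <= `|h 0 k| ->
      ball x r (x + initial_part h k + s *: delta_mx 0 k).
    move=> sh; rewrite -ball_normE/= -addrA opprD addNKr normrN.
    exact: le_lt_trans (initial_part_line_norm sh) hr.
  have := @mvt_affine_bound R (fun s => f (x + initial_part h k + s *: delta_mx 0 k))
     (fun s => 'D_(delta_mx 0 k) f (x + initial_part h k + s *: delta_mx 0 k))
     (h 0 k) ('D_(delta_mx 0 k) f x) e'.
  rewrite scale0r addr0 -[X in f X - _]addrA -initial_partS => H.
  apply: le_trans (H _ _) _.
  - by move=> s sh; apply: is_derive_line; have [] := rP _ (inball s sh) k.
  - by move=> s sh; have [] := rP _ (inball s sh) k.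
  - by apply: ler_wpM2l; [exact: ltW|exact: rV_coord_le_norm].
have dE := diff_unique cL main.
apply: DiffDef; last by rewrite dE LfE.
by apply/diff_locallyP; rewrite dE.
Unshelve. all: by end_near. Qed.

(** * Second derivatives along curves *)

Lemma is_derive_along_curve (R : realType) (n : nat) (f : 'rV[R]_n -> R)
    (gam : R -> 'rV[R]_n) (s : R) (c : 'I_n -> R) :
  (\forall y \near gam s, forall i, derivable f y (delta_mx 0 i)) ->
  (forall i, {for gam s, continuous ('D_(delta_mx 0 i) f)}) ->
  (forall i, is_derive s 1 (fun r => gam r 0 i) (c i)) ->
  is_derive s 1 (fun r => f (gam r))
    (\sum_i c i * 'D_(delta_mx 0 i) f (gam s)).
Proof.
move=> fd cf gd; have [df dE] := is_diff_partials fd cf.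
have dgam : derivable gam s 1.
  by apply/derivable_mxP => i j; rewrite ord1; have [] := gd j.
have diffgam : differentiable gam s by exact/derivable1_diffP.
have dcomp : differentiable (f \o gam) s by exact: differentiable_comp.
apply: DeriveDef; first exact/derivable1_diffP.
rewrite -[LHS]/('D_1 (f \o gam) s) deriveE// diff_comp//= dE -deriveE//.
apply: eq_bigr => i _; congr (_ * _).
by rewrite derive_mx// mxE; have [_ ->] := gd i.
Qed.

(** A relation, so that second derivatives along several families of curves can be
    combined without proving first that they exist. *)
Definition second_derive (R : realType) (h : R -> R) (s c : R) :=
  exists h1 : R -> R, (forall r : R, is_derive r 1 h (h1 r)) /\
    is_derive s 1 h1 c.

Lemma second_deriveB (R : realType) (f g : R -> R) (s a b : R) :
  second_derive f s a -> second_derive g s b ->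
  second_derive (fun r => f r - g r) s (a - b).
Proof.
move=> [f1 [fd fd2]] [g1 [gd gd2]]; exists (fun r => f1 r - g1 r); split.
  by move=> r; have := fd r; have := gd r; move=> ? ?; exact: is_deriveB.
exact: is_deriveB.
Qed.

Lemma second_deriveZ (R : realType) (f : R -> R) (k s a : R) :
  second_derive f s a -> second_derive (fun r => k * f r) s (k * a).
Proof.
move=> [f1 [fd fd2]]; exists (fun r => k * f1 r); split.
  by move=> r; have := fd r => ?; exact: is_deriveZ.
exact: is_deriveZ.
Qed.

Lemma second_derive_reflect (R : realType) (h : R -> R) (k s c : R) :
  second_derive h (k - s) c -> second_derive (fun r => h (k - r)) s c.
Proof.
have refl (f : R -> R) (r l : R) : is_derive (k - r) 1 f l ->
    is_derive r 1 (fun x => f (k - x)) (- l).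
  move=> fd; have kd : is_derive r (1 : R) (fun x : R => k - x) (-1).
    rewrite -[-1]sub0r; exact: is_deriveB (is_derive_cst _ _ _)
      (is_derive_id _ _).
  have := @is_derive1_comp R f (fun x => k - x) r l (-1).
  by rewrite mulrN1; apply.
move=> [h1 [hd hd2]]; exists (fun r => - h1 (k - r)); split.
  by move=> r; exact: refl.
by rewrite -[c]opprK; apply: is_deriveN; exact: refl.
Qed.

Lemma second_derive_cst (R : realType) (k s : R) :
  second_derive (fun=> k) s 0.
Proof. by exists (fun=> 0); split => *; exact: is_derive_cst. Qed.

(** If c < 0, then h1 changes sign from 0 to negative just after s, and h drops
    strictly below h s by the mean value theorem. *)
Lemma second_derive_min (R : realType) (h : R -> R) (s c : R) :
  second_derive h s c -> (\forall r \near s, h s <= h r) -> 0 <= c.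
Proof.
move=> [h1 [hd hd2]] /nbhs_ballP[e /= e0 he].
have hmin r : `|r - s| < e -> h s <= h r.
  by move=> rs; apply: he; rewrite /ball /= distrC.
have h1s : h1 s = 0.
  have se : s \in `]s - e, s + e[%R by rewrite in_itv/=; apply/andP; split; lra.
  have [|t|t|_] := @derive1_at_min R h (s - e) (s + e) s _ _ se _; first lra.
  - by have [] := hd t.
  - by rewrite in_itv/= => /andP[? ?]; apply: hmin; rewrite ltr_norml; lra.
  - by have [_ <-] := hd s.
rewrite leNgt; apply/negP => c0.
have : \forall k \near (0 : R)^', k^-1 * (h1 (k + s) - h1 s) < 0.
  have [cd cE] := hd2.
  have H : (k^-1 *: ((h1 \o shift s) (k *: (1 : R)) - h1 s)) @[k --> 0^'] --> c.
    by rewrite -cE.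
  have /H : \forall y \near c, y < 0 by exact: lt_nbhsl.
  rewrite /nbhs/=; apply: filterS => k /=.
  by rewrite -[k%:A]/(k * 1) mulr1.
rewrite near_withinE => /nbhs_ballP[d /= d0 hd'].
pose m := Num.min d e / 2.
have [m0 md me] : [/\ 0 < m, m < d & m < e].
  have M0 : 0 < Num.min d e by rewrite lt_min d0.
  have Md : Num.min d e <= d by rewrite ge_min lexx.
  have Me : Num.min d e <= e by rewrite ge_min lexx orbT.
  by rewrite /m; split; lra.
have neg r : s < r -> r <= s + m -> h1 r < 0.
  move=> sr rm; have := hd' (r - s).
  rewrite /ball/= sub0r normrN gtr0_norm ?subr_gt0// => /(_ _ _).
  rewrite h1s subr0 subrK pmulr_rlt0 ?invr_gt0 ?subr_gt0//; apply; first lra.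
  by rewrite subr_eq0 gt_eqF.
have [||x] := @MVT R h h1 s (s + m).
- by rewrite ltrDl.
- apply: continuous_subspaceT => x.
  by apply/differentiable_continuous/derivable1_diffP; have [] := hd x.
rewrite in_itv/= => /andP[sx xm] E.
have /hmin : `|s + m - s| < e by rewrite addrAC subrr add0r gtr0_norm.
rewrite -subr_ge0 E addrAC subrr add0r leNgt pmulr_llt0// => /negP; apply.
by apply: neg => //; exact: ltW.
Qed.

(** * Cooperative systems on a cylinder *)

Lemma continuous_pair_for (X Y Z : topologicalType) (f : X -> Y) (h : X -> Z)
    (x : X) : {for x, continuous f} -> {for x, continuous h} ->
  {for x, continuous (fun x => (f x, h x))}.
Proof. by move=> cf ch; exact: (cvg_pair cf ch). Qed.

Definition row2 (R : realType) (y : 'I_2 -> R) : 'rV[R]_2 := \row_j y j.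

(** One-sided, because the comparison argument lowers the components of w towards
    those of its mirror image. *)
Definition lipschitz_below (R : realType) (T : Type) (S : set T)
    (g : 'I_2 -> R -> T -> 'rV[R]_2 -> R) (w : 'I_2 -> R -> T -> R)
    (l t1 : R) (i : 'I_2) : Prop :=
  forall t th (Y : 'rV[R]_2), t <= t1 -> S th -> open_orthant Y ->
    (forall j, Y 0 j <= w j t th) ->
    g i t th (row2 (fun j => w j t th)) - g i t th Y
      <= l * \sum_j (w j t th - Y 0 j).

(** The abstract setting of the moving plane method on R x S.  The base S enters
    through the curves s -> rot j s th, along which second derivatives add up to its
    Laplacian; [cs_small] expresses that the nonlinearity is a small perturbation of
    - kappa w near t = -oo. *)
Record cylinder_system (R : realType) (T : topologicalType) (S : set T)
    (J : finType) (rot : J -> R -> T -> T) (kappa : R)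
    (g : 'I_2 -> R -> T -> 'rV[R]_2 -> R) (w : 'I_2 -> R -> T -> R)
    : Prop := CylinderSystem {
  cs_kappa : 0 < kappa;
  cs_compact : compact S;
  cs_rot0 : forall j th, rot j 0 th = th;
  cs_rotS : forall j s th, S th -> S (rot j s th);
  cs_pos : forall i t th, 0 < w i t th;
  cs_cont : forall i, continuous (fun p : R * T => w i p.1 p.2);
  cs_decay : forall e, 0 < e -> exists t0, forall i t th, t <= t0 -> S th ->
    w i t th <= e;
  cs_mono : forall i t t' th Y, t < t' -> S th -> open_orthant Y ->
    g i t th Y < g i t' th Y;
  cs_coop : forall i t th Y Z, S th -> open_orthant Y -> open_orthant Z ->
    (forall j, Y 0 j <= Z 0 j) -> Y 0 i = Z 0 i -> g i t th Y <= g i t th Z;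
  cs_lip : forall t1, exists l, 0 < l /\ forall i, lipschitz_below S g w l t1 i;
  cs_small : forall l, 0 < l -> exists t0,
    forall i, lipschitz_below S g w l t0 i;
  cs_eq : forall i t th, S th -> exists d0 (d : J -> R),
    [/\ second_derive (fun r => w i r th) t d0,
        forall j, second_derive (fun s => w i t (rot j s th)) 0 (d j) &
        d0 + \sum_j d j
          = kappa * w i t th - g i t th (row2 (fun j => w j t th))]
}.

Lemma fin_compact_min (R : realType) (T : topologicalType) (K : set T)
    (q : 'I_2 -> T -> R) :
  K !=set0 -> compact K -> (forall i p, K p -> {for p, continuous (q i)}) ->
  exists i p, K p /\ forall j p', K p' -> q i p <= q j p'.
Proof.
move=> K0 cK cq.
have exmin i : exists p, K p /\ forall p', K p' -> q i p <= q i p'.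
  have [|p pK pmin] := @compact_EVT_min T R (q i) K K0 cK.
    by apply: continuous_in_subspaceT => p /set_mem; exact: cq.
  by exists p; split; [exact: set_mem|move=> p' p'K; apply: pmin; exact: mem_set].
have [P PP] := choice exmin.
have [i _ imin] := arg_minP (fun i : 'I_2 => q i (P i)) (i0 := ord0) (P := xpredT) isT.
exists i, (P i); split; first by have [] := PP i.
by move=> j p' Kp'; apply: le_trans (imin j isT) _; have [_] := PP j; exact.
Qed.

Definition reflected (R : realType) (T : topologicalType)
  (w : 'I_2 -> R -> T -> R) (tau : R) (i : 'I_2) (t : R) (th : T) : R :=
  w i (2 * tau - t) th - w i t th.

Lemma continuous_reflected (R : realType) (T : topologicalType)
    (w : 'I_2 -> R -> T -> R) (tau : R) (i : 'I_2) :
  continuous (fun p : R * T => w i p.1 p.2) ->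
  continuous (fun p : R * T => reflected w tau i p.1 p.2).
Proof.
move=> cw p; rewrite /reflected.
have cfst : {for p, continuous (@fst R T)} by exact: cvg_fst.
apply: (@continuousB _ _ _ (fun p => w i (2 * tau - p.1) p.2)
  (fun p => w i p.1 p.2)); last exact: cw.
apply: (@continuous_comp _ _ _ (fun p : R * T => (2 * tau - p.1, p.2))
  (fun p : R * T => w i p.1 p.2)); last exact: cw.
apply: continuous_pair_for; last exact: cvg_snd.
by apply: (@continuousB _ _ _ (fun=> 2 * tau) fst) => //; exact: cst_continuous.
Qed.

(** A concave parabola: the positive weight that makes the maximum principle hold on
    a strip which is narrow compared with its second derivative. *)
Definition cap (R : realType) (A c t : R) : R := 1 - A * (t - c) ^+ 2.

Lemma second_derive_cap (R : realType) (A c s : R) :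
  second_derive (cap A c) s (- (2 * A)).
Proof.
exists (fun t => - (2 * A * (t - c))); split.
  move=> r; rewrite /cap; apply: is_derive_eq.
  rewrite /GRing.scale/=; ring.
apply: is_derive_eq; rewrite /GRing.scale/=; ring.
Qed.

Lemma continuous_cap (R : realType) (A c : R) : continuous (cap A c).
Proof.
move=> t; have [h1 [hd _]] := second_derive_cap A c t.
by apply/differentiable_continuous/derivable1_diffP; have [] := hd t.
Qed.

(** Where the graph of m times the weight touches z from below, the second
    derivatives of z dominate those of m times the weight, whose Laplacian is - 2 A m because it
    depends on t alone.  The equations at the mirror images (2 tau - t, th) and
    (t, th), subtracted, turn this into a pointwise inequality. *)
Lemma cylinder_touching (R : realType) (T : topologicalType) (S : set T)
    (J : finType) (rot : J -> R -> T -> T) (kappa : R)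
    (g : 'I_2 -> R -> T -> 'rV[R]_2 -> R) (w : 'I_2 -> R -> T -> R)
    (tau A c m lo hi t : R) (th : T) (i : 'I_2) :
  cylinder_system S rot kappa g w ->
  lo < t -> t < hi -> S th ->
  (forall r th', lo <= r -> r <= hi -> S th' ->
     m * cap A c r <= reflected w tau i r th') ->
  reflected w tau i t th = m * cap A c t ->
  - (2 * A * m) <= kappa * reflected w tau i t th
     - (g i (2 * tau - t) th (row2 (fun j => w j (2 * tau - t) th))
        - g i t th (row2 (fun j => w j t th))).
Proof.
move=> cs lot thi Sth zmin zt.
have [a0 [a [a0d ad aE]]] := cs_eq cs i (2 * tau - t) Sth.
have [b0 [b [b0d bd bE]]] := cs_eq cs i t Sth.
have dt : 0 <= a0 - b0 - m * (- (2 * A)).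
  apply: (@second_derive_min R
    (fun r => reflected w tau i r th - m * cap A c r) t).
    apply: second_deriveB; last exact/second_deriveZ/second_derive_cap.
    apply: second_deriveB b0d.
    exact: (@second_derive_reflect R (fun r => w i r th)).
  have nt : \forall r \near t, r \in `]lo, hi[%R.
    by apply: near_in_itvoo; rewrite in_itv/= lot.
  apply: filterS nt => r; rewrite in_itv/= => /andP[lor rhi].
  by rewrite zt subrr subr_ge0 zmin// ltW.
have ds j : 0 <= a j - b j.
  apply: (@second_derive_min R
    (fun s => reflected w tau i t (rot j s th)) 0).
    exact: second_deriveB (ad j) (bd j).
  apply: (@filterE _ (nbhs (0 : R))) => s; rewrite (cs_rot0 cs) zt; apply: zmin; rewrite ?ltW//.
  exact: cs_rotS cs _ _ _ Sth.
have : 0 <= \sum_j (a j - b j) by exact: sumr_ge0.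
rewrite sumrB; move: aE bE dt; rewrite /reflected => aE bE; nra.
Qed.

Lemma capE0 (R : realType) (c t : R) : cap 0 c t = 1.
Proof. by rewrite /cap mul0r subr0. Qed.

(** Consider the smallest value m of the quotients z_j / cap over the closed strip
    and both components, and suppose m < - e.  It is attained inside the strip.  At that
    point lower w to the componentwise minimum with its mirror image: monotonicity
    in t, cooperativity and the Lipschitz bound give
    2 A <= cap * (2 l - kappa), against the hypothesis.  The factor 2 counts the
    components, each of which is lowered by at most - m * cap. *)
Lemma strip_comparison (R : realType) (T : topologicalType) (S : set T)
    (J : finType) (rot : J -> R -> T -> T) (kappa : R)
    (g : 'I_2 -> R -> T -> 'rV[R]_2 -> R) (w : 'I_2 -> R -> T -> R)
    (tau A c lo hi l e : R) :
  cylinder_system S rot kappa g w ->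
  hi <= tau -> 0 <= e -> 0 < l ->
  (forall t, lo <= t -> t <= hi ->
     0 < cap A c t /\ cap A c t * (2 * l - kappa) < 2 * A) ->
  (forall i, lipschitz_below S g w l hi i) ->
  (forall i th, S th -> - (e * cap A c lo) <= reflected w tau i lo th) ->
  (forall i th, S th -> - (e * cap A c hi) <= reflected w tau i hi th) ->
  forall i t th, lo <= t -> t <= hi -> S th ->
    - (e * cap A c t) <= reflected w tau i t th.
Proof.
move=> cs hitau e0 l0 capP lip zlo zhi i0 t0 th0 lot0 t0hi Sth0.
rewrite leNgt; apply/negP => zneg.
pose K := (`[lo, hi] : set R) `*` S.
pose q i (p : R * T) := reflected w tau i p.1 p.2 / cap A c p.1.
have inK t th : lo <= t -> t <= hi -> S th -> K (t, th).
  by move=> ? ? ?; split => //=; rewrite in_itv/=; apply/andP.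
have [|||i [[t th] [[/= tK Sth] qmin]]] := @fin_compact_min R _ K q.
- by exists (t0, th0); exact: inK.
- by apply: compact_setX; [exact: segment_compact|exact: cs_compact cs].
- move=> j [t th] [/= tK Sth]; move: tK; rewrite in_itv/= => /andP[lot thi].
  apply: (@continuousM _ _ (fun p => reflected w tau j p.1 p.2)
    (fun p => (cap A c p.1)^-1)).
    by apply: continuous_reflected; exact: cs_cont cs j.
  apply: (@continuousV _ _ (fun p : R * T => cap A c p.1)).
    by rewrite /= gt_eqF//; have [] := capP _ lot thi.
  apply: (@continuous_comp _ _ _ fst); first exact: cvg_fst.
  exact: continuous_cap.
move: tK; rewrite in_itv/= => /andP[lot thi].
have [capt capl] := capP _ lot thi.
pose m := q i (t, th).
have zm : reflected w tau i t th = m * cap A c t.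
  by rewrite /m/q/= divfK// gt_eqF.
have zge r j th' : lo <= r -> r <= hi -> S th' ->
    m * cap A c r <= reflected w tau j r th'.
  move=> lor rhi Sth'; have [capr _] := capP _ lor rhi.
  by rewrite -ler_pdivlMr//; exact: (qmin j (r, th') (inK _ _ lor rhi Sth')).
have me : m < - e.
  have [cap0 _] := capP _ lot0 t0hi.
  rewrite -(ltr_pM2r cap0) mulNr; apply: le_lt_trans zneg; exact: zge.
have m0 : m < 0 by lra.
have lot' : lo < t.
  rewrite lt_neqAle lot andbT; apply/eqP => lt_; move: (zlo i th Sth).
  by rewrite lt_ zm -mulNr ler_pM2r// leNgt me.
have thi' : t < hi.
  rewrite lt_neqAle thi andbT; apply/eqP => lt_; move: (zhi i th Sth).
  by rewrite -lt_ zm -mulNr ler_pM2r// leNgt me.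
have := cylinder_touching (A := A) (c := c) (m := m) cs lot' thi' Sth
  (fun r th' h1 h2 h3 => zge r i th' h1 h2 h3) zm.
set Wr := row2 (fun j => w j (2 * tau - t) th).
set W := row2 (fun j => w j t th) => touch.
(* V has the same i-th component as Wr, so that cooperativity compares the two,
   and lies below W, so that the Lipschitz bound applies. *)
pose V := row2 (fun j => Num.min (w j (2 * tau - t) th) (w j t th)).
have Wro : open_orthant Wr by move=> j; rewrite mxE; exact: cs_pos cs _ _ _.
have Vo : open_orthant V.
  by move=> j; rewrite mxE lt_min; apply/andP; split; exact: cs_pos cs _ _ _.
have zneg' : w i (2 * tau - t) th < w i t th.
  by rewrite -subr_lt0 -[X in X < 0]/(reflected w tau i t th) zm nmulr_rlt0.
have g1 : g i t th Wr < g i (2 * tau - t) th Wr.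
  by apply: (cs_mono cs) => //; lra.
have g2 : g i t th V <= g i t th Wr.
  apply: (cs_coop cs) => //.
    by move=> j; rewrite !mxE ge_min lexx.
  by rewrite !mxE; apply: min_l; exact: ltW.
have g3 : g i t th W - g i t th V <= l * \sum_j (w j t th - V 0 j).
  apply: lip => //.
  by move=> j; rewrite !mxE ge_min lexx orbT.
have : \sum_j (w j t th - V 0 j) <= \sum_(j < 2) (- (m * cap A c t)).
  apply: ler_sum => j _; rewrite mxE; have := zge t j th lot thi Sth.
  rewrite /reflected => zj.
  have mc0 : m * cap A c t < 0 by rewrite nmulr_rlt0.
  by case: (leP (w j (2 * tau - t) th) (w j t th)) => ?; lra.
rewrite sumr_const card_ord -mulr_natl => s1.
have s2 : l * \sum_j (w j t th - V 0 j) <= l * (2%:R * - (m * cap A c t)).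
  by rewrite ler_pM2l.
have : (2 * A - cap A c t * (2 * l - kappa)) * m < 0.
  by rewrite pmulr_rlt0// subr_gt0.
move: touch g1 g2 g3 s2; rewrite zm; nra.
Qed.

Definition mirror_ordered (R : realType) (T : topologicalType) (S : set T)
    (w : 'I_2 -> R -> T -> R) (tau : R) : Prop :=
  forall i t th, t <= tau -> S th -> 0 <= reflected w tau i t th.

(** At an interior zero, z_i is minimal, so its Laplacian is nonnegative; but it
    equals the negative of an increment of g_i that is positive, since g_i is
    strictly increasing in t and cooperative. *)
Lemma mirror_ordered_strict (R : realType) (T : topologicalType) (S : set T)
    (J : finType) (rot : J -> R -> T -> T) (kappa : R)
    (g : 'I_2 -> R -> T -> 'rV[R]_2 -> R) (w : 'I_2 -> R -> T -> R) (tau : R) :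
  cylinder_system S rot kappa g w -> mirror_ordered S w tau ->
  forall i t th, t < tau -> S th -> 0 < reflected w tau i t th.
Proof.
move=> cs ord i t th ttau Sth; rewrite lt_neqAle ord ?ltW// andbT.
apply/eqP => /esym z0.
have ltt : t - 1 < t by lra.
have := @cylinder_touching R T S J rot kappa g w tau 0 0 0 (t - 1) tau t th i cs
  ltt ttau Sth.
rewrite z0 mul0r => /(_ _ erefl).
have : forall (r : R) (th' : T), t - 1 <= r -> r <= tau -> S th' ->
    0 * cap 0 0 r <= reflected w tau i r th'.
  by move=> r th' _ rtau Sth'; rewrite mul0r; exact: ord.
move=> /[swap] /[apply].
set Wr := row2 (fun j => w j (2 * tau - t) th).
set W := row2 (fun j => w j t th).
have Wro : open_orthant Wr by move=> j; rewrite mxE; exact: cs_pos cs _ _ _.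
have Wo : open_orthant W by move=> j; rewrite mxE; exact: cs_pos cs _ _ _.
have g1 : g i t th Wr < g i (2 * tau - t) th Wr.
  by apply: (cs_mono cs) => //; lra.
have g2 : g i t th W <= g i t th Wr.
  apply: (cs_coop cs) => //.
    by move=> j; rewrite !mxE -subr_ge0; apply: ord => //; exact: ltW.
  by rewrite !mxE; apply/esym/eqP; rewrite -subr_eq0; apply/eqP.
lra.
Qed.

(** With the constant weight 1, [strip_comparison] asks for 2 l < kappa, which holds
    far to the left.  Decay of w makes z >= - e at a remote left end, for any e > 0.
    The bound t0 does not depend on the position tau of the mirror. *)
Lemma mirror_ordered_far_left (R : realType) (T : topologicalType) (S : set T)
    (J : finType) (rot : J -> R -> T -> T) (kappa : R)
    (g : 'I_2 -> R -> T -> 'rV[R]_2 -> R) (w : 'I_2 -> R -> T -> R) :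
  cylinder_system S rot kappa g w ->
  exists t0, forall tau hi, hi <= tau -> hi <= t0 ->
    (forall i th, S th -> 0 <= reflected w tau i hi th) ->
    forall i t th, t <= hi -> S th -> 0 <= reflected w tau i t th.
Proof.
move=> cs; have k0 := cs_kappa cs.
have l0 : 0 < kappa / 4 by lra.
have [t0 lip] := cs_small cs l0; exists t0 => tau hi hitau hit0 zhi i t th thi Sth.
rewrite leNgt; apply/negP => zneg.
(* Any e below the depth of the negative value would do. *)
pose e := - reflected w tau i t th / 2.
have e0 : 0 < e by rewrite /e; lra.
have [t1 dec] := cs_decay cs e0.
pose lo := Num.min t t1.
have lot : lo <= t by rewrite ge_min lexx.
have lot1 : lo <= t1 by rewrite ge_min lexx orbT.
have : - (e * cap 0 0 t) <= reflected w tau i t th; last first.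
  by rewrite capE0 /e; lra.
apply: (@strip_comparison R T S J rot kappa g w tau 0 0 lo hi (kappa / 4) e cs
  hitau (ltW e0) l0) => //.
- by move=> r _ _; rewrite capE0; split; lra.
- by move=> j r th' Y rhi; apply: lip; exact: le_trans hit0.
- move=> j th' Sth'; rewrite capE0 mulr1 /reflected.
  have := dec j lo th' lot1 Sth'; have := cs_pos cs j (2 * tau - lo) th'; lra.
- by move=> j th' Sth'; rewrite capE0; have := zhi j th' Sth'; lra.
Qed.

(** * Moving the mirror *)

(** Tube lemma: positivity on a compact set persists under small moves of the
    mirror. *)
Lemma near_reflected_gt0 (R : realType) (T : topologicalType) (K : set (R * T))
    (w : 'I_2 -> R -> T -> R) (tau : R) :
  (forall i, continuous (fun p : R * T => w i p.1 p.2)) -> compact K ->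
  (forall i t th, K (t, th) -> 0 < reflected w tau i t th) ->
  \forall s \near tau, forall i t th, K (t, th) -> 0 < reflected w s i t th.
Proof.
move=> cw cK pos.
have H : \forall s \near tau,
    forall i, K `<=` [set p | 0 < reflected w s i p.1 p.2]; last first.
  by near=> s => i t th; exact: (near H s _ i (t, th)).
apply: (@filter_forall _ _ _ _ (nbhs_filter tau)) => i.
move/compact_near_coveringP : cK.
apply => -[t th] Kp.
have cf : {for ((t, th), tau), continuous (fun z : (R * T) * R =>
    reflected w z.2 i z.1.1 z.1.2)}.
  have c1 : {for ((t, th), tau), continuous (fun z : (R * T) * R => z.1)}.
    exact: cvg_fst.
  have c2 : {for ((t, th), tau), continuous (fun z : (R * T) * R => z.2)}.
    exact: cvg_snd.
  have c11 : {for ((t, th), tau), continuous (fun z : (R * T) * R => z.1.1)}.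
    by apply: (continuous_comp c1); exact: cvg_fst.
  have c12 : {for ((t, th), tau), continuous (fun z : (R * T) * R => z.1.2)}.
    by apply: (continuous_comp c1); exact: cvg_snd.
  apply: (@continuousB _ _ _
    (fun z : (R * T) * R => w i (2 * z.2 - z.1.1) z.1.2)
    (fun z : (R * T) * R => w i z.1.1 z.1.2)).
    apply: (@continuous_comp _ _ _
      (fun z : (R * T) * R => (2 * z.2 - z.1.1, z.1.2))
      (fun p => w i p.1 p.2)); last exact: cw.
    apply: continuous_pair_for => //.
    apply: (@continuousB _ _ _ (fun z : (R * T) * R => 2 * z.2)) => //.
    by apply: (@continuousM _ _ (fun=> 2)) => //; exact: cst_continuous.
  by apply: (@continuous_comp _ _ _ fst (fun p : R * T => w i p.1 p.2) _ c1);
    exact: cw.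
have /cf : \forall y \near reflected w tau i t th, 0 < y.
  by apply: lt_nbhsr; exact: pos.
exact.
Unshelve. all: by end_near. Qed.

(** Split t <= s in three: far to the left the sign of z propagates from the
    boundary;
    on the compact middle part z stays positive; the strip
    between tau - eta and s is thin enough for the weight cap C tau. *)
Lemma mirror_ordered_open_right (R : realType) (T : topologicalType) (S : set T)
    (J : finType) (rot : J -> R -> T -> T) (kappa : R)
    (g : 'I_2 -> R -> T -> 'rV[R]_2 -> R) (w : 'I_2 -> R -> T -> R) (tau : R) :
  cylinder_system S rot kappa g w -> mirror_ordered S w tau ->
  exists e, 0 < e /\
    forall s, tau <= s -> s <= tau + e -> mirror_ordered S w s.
Proof.
move=> cs ord; have k0 := cs_kappa cs.
have [C [C0 lip]] := cs_lip cs (tau + 1).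
(* This width gives C eta^2 <= 1/2, hence 1/2 <= cap C tau <= 1 at distance at most
   eta from tau. *)
pose eta := (2 * (C + 1))^-1.
have C1 : 0 < 2 * (C + 1) by lra.
have eta0 : 0 < eta by rewrite invr_gt0.
have etaC : eta * (2 * (C + 1)) = 1 by rewrite mulVf// gt_eqF.
have eta1 : eta <= 1 by nra.
have Ceta : C * eta ^+ 2 <= 1 / 2 by nra.
have [t0 left] := mirror_ordered_far_left cs.
pose t1 := Num.min t0 (tau - eta).
have t1t0 : t1 <= t0 by rewrite ge_min lexx.
have t1tau : t1 <= tau - eta by rewrite ge_min lexx orbT.
have : \forall s \near tau, forall i t th,
    ((`[t1, tau - eta] : set R) `*` S) (t, th) -> 0 < reflected w s i t th.
  apply: near_reflected_gt0; first exact: cs_cont cs.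
    by apply: compact_setX; [exact: segment_compact|exact: cs_compact cs].
  move=> i t th [/= + Sth]; rewrite in_itv/= => /andP[_ tt].
  by apply: (mirror_ordered_strict cs ord) => //; lra.
move=> /nbhs_ballP[d /= d0 mid].
pose e := Num.min d eta / 2.
have M0 : 0 < Num.min d eta by rewrite lt_min d0.
have Md : Num.min d eta <= d by rewrite ge_min lexx.
have Me : Num.min d eta <= eta by rewrite ge_min lexx orbT.
have [e0 ed eeta] : [/\ 0 < e, e < d & e < eta] by rewrite /e; split; lra.
exists e; split => // s taus se.
have {}mid i t th : t1 <= t -> t <= tau - eta -> S th -> 0 < reflected w s i t th.
  move=> t1t tt Sth; apply: (mid s).
    by rewrite /ball/= distrC ger0_norm ?subr_ge0//; lra.
  by split => //=; rewrite in_itv/= t1t.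
move=> i t th ts Sth.
have [tt1|/ltW t1t] := leP t t1.
  apply: (left s t1) => //; first by lra.
  by move=> j th' Sth'; apply/ltW/mid.
have [tt|/ltW tt] := leP t (tau - eta); first exact/ltW/mid.
have : - (0 * cap C tau t) <= reflected w s i t th; last by rewrite mul0r oppr0.
apply: (@strip_comparison R T S J rot kappa g w s C tau (tau - eta) s C 0 cs)
  => //.
- move=> r r1 r2; rewrite /cap.
  have : (r - tau) ^+ 2 <= eta ^+ 2 by nra.
  have := sqr_ge0 (r - tau); set x := (r - tau) ^+ 2 => x0 xe.
  have : C * x <= C * eta ^+ 2 by rewrite ler_pM2l.
  have : 0 <= C * x by nra.
  by split; [lra|nra].
- by move=> j r th' Y rs; apply: lip; lra.
- by move=> j th' Sth'; rewrite mul0r oppr0; apply/ltW/mid.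
- move=> j th' Sth'; rewrite mul0r oppr0 /reflected.
  by rewrite (_ : 2 * s - s = s) ?subrr//; ring.
Qed.

(** At the infimum of the bad positions, either the order holds and then persists to
    the right, or it fails at some t < tau and then, by continuity, fails slightly
    to the left as well. *)
Lemma mirror_ordered_all (R : realType) (T : topologicalType) (S : set T)
    (J : finType) (rot : J -> R -> T -> T) (kappa : R)
    (g : 'I_2 -> R -> T -> 'rV[R]_2 -> R) (w : 'I_2 -> R -> T -> R) (tau : R) :
  cylinder_system S rot kappa g w -> mirror_ordered S w tau.
Proof.
move=> cs; apply: contrapT => bad.
pose B := [set s | ~ mirror_ordered S w s].
have [t0 left] := mirror_ordered_far_left cs.
have B0 : has_inf B.
  split; first by exists tau.
  exists t0 => s Bs; rewrite leNgt; apply/negP => st0; apply: Bs.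
  move=> i t th ts Sth; apply: (left s s) => //; first exact: ltW.
  move=> j th' Sth'; rewrite /reflected (_ : 2 * s - s = s) ?subrr//; ring.
have [good|] := pselect (mirror_ordered S w (inf B)).
  have [e [e0 right]] := mirror_ordered_open_right cs good.
  have [s Bs sB] := inf_adherent e0 B0.
  by apply: (Bs); apply: right; [exact: ge_inf B0.2 _ Bs|exact: ltW].
move=> /existsNP[i /existsNP[t /existsNP[th /not_implyP[tB /not_implyP[Sth]]]]].
move=> /negP; rewrite -ltNge => zneg.
have tB' : t < inf B.
  rewrite lt_neqAle tB andbT; apply/eqP => E; move: zneg.
  by rewrite -E /reflected (_ : 2 * t - t = t) ?subrr ?ltxx//; ring.
have cz : {for inf B, continuous (fun s => reflected w s i t th)}.
  apply: (@continuousB R R R (fun s : R => w i (2 * s - t) th) (fun=> w i t th));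
    last exact: cst_continuous.
  apply: (@continuous_comp _ _ _ (fun s : R => (2 * s - t, th))
    (fun p => w i p.1 p.2)); last exact: cs_cont cs _ _.
  apply: continuous_pair_for; last exact: cst_continuous.
  apply: (@continuousB _ _ _ (fun s : R => 2 * s)); last exact: cst_continuous.
  apply: (@continuousM _ _ (fun=> 2)); first exact: cst_continuous.
  exact: cvg_id.
have near1 : \forall s \near inf B, reflected w s i t th < 0.
  by apply: (cz [set y | y < 0]); exact: lt_nbhsl.
have near2 : \forall s \near inf B, t < s by exact: lt_nbhsr.
have : \forall s \near inf B, reflected w s i t th < 0 /\ t < s.
  exact: filterI near1 near2.
move=> /nbhs_ballP[d /= d0 H].
have [|sneg ts] := H (inf B - d / 2).
  by rewrite /ball/= opprB addrCA subrr addr0 ger0_norm; lra.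
have : B (inf B - d / 2).
  move=> /(_ i t th (ltW ts) Sth); rewrite leNgt => /negP; exact.
by move/(ge_inf B0.2); lra.
Qed.

(** The mirror halfway between t and t' exchanges them. *)
Lemma cylinder_solution_nondecreasing (R : realType) (T : topologicalType)
    (S : set T) (J : finType) (rot : J -> R -> T -> T) (kappa : R)
    (g : 'I_2 -> R -> T -> 'rV[R]_2 -> R) (w : 'I_2 -> R -> T -> R) :
  cylinder_system S rot kappa g w ->
  forall i t t' th, t <= t' -> S th -> w i t th <= w i t' th.
Proof.
move=> cs i t t' th tt' Sth.
have ttau : t <= (t + t') / 2 by lra.
have := mirror_ordered_all (tau := (t + t') / 2) cs i ttau Sth.
by rewrite /reflected subr_ge0 (_ : 2 * ((t + t') / 2) - t = t')//; field.
Qed.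

(** * Superlinear growth excludes solutions *)

Lemma is_derive_subr (R : realType) (k r : R) :
  is_derive r 1 (fun x : R => x - k) 1.
Proof.
rewrite -[X in is_derive _ _ _ X]subr0.
exact: is_deriveB (is_derive_id _ _) (is_derive_cst _ _ _).
Qed.

Lemma second_derive_sin (R : realType) (k s : R) :
  second_derive (fun r => sin (r - k)) s (- sin (s - k)).
Proof.
exists (fun r => cos (r - k)); split=> [r|].
  have := @is_derive1_comp R sin (fun x => x - k) r (cos (r - k)) 1
    (is_derive_sin _) (is_derive_subr k r).
  by rewrite mulr1.
have := @is_derive1_comp R cos (fun x => x - k) s (- sin (s - k)) 1
  (is_derive_cos _) (is_derive_subr k s).
by rewrite mulr1.
Qed.

(** The function sin (t - k) is the first Dirichlet eigenfunction of a strip of width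
    pi, with eigenvalue 1.  The largest multiple of it that stays below w_i touches
    w_i inside the strip, where the Laplacian of w_i is then at least - w_i; but the
    growth of g_i forces it to be at most - 2 w_i. *)
Lemma cylinder_no_solution (R : realType) (T : topologicalType) (S : set T)
    (J : finType) (rot : J -> R -> T -> T) (kappa : R)
    (g : 'I_2 -> R -> T -> 'rV[R]_2 -> R) (w : 'I_2 -> R -> T -> R) (i : 'I_2) :
  cylinder_system S rot kappa g w -> S !=set0 ->
  (forall c : R, 0 < c -> exists t0, forall t th (Y : 'rV[R]_2),
     t0 <= t -> S th ->
     (forall j, c <= Y 0 j) -> (kappa + 2) * Y 0 i <= g i t th Y) ->
  False.
Proof.
move=> cs [th0 Sth0] growth.
have mono := cylinder_solution_nondecreasing cs.
have [c [c0 wc]] : exists c : R, 0 < c /\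
    forall j t th, 0 <= t -> S th -> c <= w j t th.
  have [||j p _|j [[t th] [[/= + Sth] qmin]]] := @fin_compact_min R (R * T)%type
      ((`[0, 0] : set R) `*` S) (fun j p => w j p.1 p.2).
  - by exists (0, th0); split => //=; rewrite in_itv/= lexx.
  - by apply: compact_setX; [exact: segment_compact|exact: cs_compact cs].
  - exact: cs_cont cs j p.
  rewrite in_itv/= -eq_le => /eqP t0.
  exists (w j t th); split; first exact: cs_pos cs _ _ _.
  move=> j' t' th' t'0 Sth'; apply: le_trans (mono _ _ _ _ t'0 Sth').
  by apply: (qmin j' (0, th')); split => //=; rewrite in_itv/= lexx.
have [t0 gr] := growth c c0.
pose k := Num.max t0 0.
have kt0 : t0 <= k by rewrite le_max lexx.
have k0 : 0 <= k by rewrite le_max lexx orbT.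
have pi0 := pi_gt0 R.
pose K := (`[k, k + pi] : set R) `*` S.
have inK t th : k <= t -> t <= k + pi -> S th -> (t, th) \in K.
  by move=> ? ? ?; apply/mem_set; split => //=; rewrite in_itv/=; apply/andP.
have [|||[t th] /set_mem[/= + Sth] qmax] := @compact_EVT_max (R * T)%type R
   (fun p => sin (p.1 - k) / w i p.1 p.2) K.
- by exists (k, th0); apply/set_mem/inK => //; lra.
- by apply: compact_setX; [exact: segment_compact|exact: cs_compact cs].
- apply: continuous_subspaceT => p.
  apply: (@continuousM R (R * T)%type (fun p => sin (p.1 - k))
    (fun p => (w i p.1 p.2)^-1)).
    apply: (@continuous_comp _ _ _ fst (fun r => sin (r - k)));
      first exact: cvg_fst.
    have [h1 [hd _]] := second_derive_sin k p.1.
    by apply/differentiable_continuous/derivable1_diffP; have [] := hd p.1.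
  apply: (@continuousV R _ (fun p : R * T => w i p.1 p.2)).
    by rewrite gt_eqF//; exact: cs_pos cs _ _ _.
  exact: cs_cont cs i p.
rewrite in_itv/= => /andP[kt tk].
have wt := cs_pos cs i t th.
have sint : 0 < sin (t - k).
  have := qmax (k + pi / 2, th0) (inK _ _ _ _ Sth0).
  move=> /(_ ltac:(lra) ltac:(lra)) /=.
  rewrite addrAC subrr add0r sin_pihalf => H.
  have : 0 < sin (t - k) / w i t th.
    by apply: lt_le_trans H; rewrite divr_gt0//; exact: cs_pos cs _ _ _.
  by rewrite pmulr_lgt0// invr_gt0.
have kt' : k < t.
  rewrite lt_neqAle kt andbT; apply/eqP => E; move: sint.
  by rewrite E subrr sin0 ltxx.
have tk' : t < k + pi.
  rewrite lt_neqAle tk andbT; apply/eqP => E; move: sint.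
  by rewrite E addrAC subrr add0r sinpi ltxx.
(* Maximising the quotient sin / w, which is continuous up to the ends of the strip,
   gives the largest multiple q of the sine below w. *)
pose q := w i t th / sin (t - k).
have touch r th' : k <= r -> r <= k + pi -> S th' ->
    q * sin (r - k) <= w i r th'.
  move=> kr rk Sth'; have wr := cs_pos cs i r th'.
  have /= H := qmax (r, th') (inK _ _ kr rk Sth').
  rewrite /q mulrAC ler_pdivrMr// mulrC -ler_pdivlMr//.
  by rewrite -mulrA [w i r th' * _]mulrC -ler_pdivrMr.
have qt : q * sin (t - k) = w i t th by rewrite /q divfK// gt_eqF.
have [d0 [d [d0d dd dE]]] := cs_eq cs i t Sth.
have dt : 0 <= d0 - q * (- sin (t - k)).
  apply: (@second_derive_min R (fun r => w i r th - q * sin (r - k)) t).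
    by apply: second_deriveB => //; exact/second_deriveZ/second_derive_sin.
  have nt : \forall r \near t, r \in `]k, k + pi[%R.
    by apply: near_in_itvoo; rewrite in_itv/= kt'.
  apply: filterS nt => r; rewrite in_itv/= => /andP[kr rk].
  by rewrite qt subrr subr_ge0 touch// ltW.
have ds j : 0 <= d j.
  apply: (@second_derive_min R (fun s => w i t (rot j s th)) 0) => //.
  apply: (@filterE _ (nbhs (0 : R))) => s.
  by rewrite (cs_rot0 cs) -qt; apply: touch => //; exact: cs_rotS cs _ _ _ Sth.
have : 0 <= \sum_j d j by exact: sumr_ge0.
have := gr t th (row2 (fun j => w j t th)).
rewrite mxE => /(_ (le_trans kt0 kt) Sth).
have cw j : c <= row2 (fun j => w j t th) 0 j.
  by rewrite mxE; apply: wc => //; exact: le_trans k0 kt.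
move=> /(_ cw); move: dE dt; rewrite mulrN qt; nra.
Qed.

(** * The Euclidean norm, the unit sphere and rotations of coordinate planes *)

Lemma enorm_sqr (R : realType) (n : nat) (x : 'rV[R]_n) :
  enorm x ^+ 2 = \sum_i x 0 i ^+ 2.
Proof. by rewrite sqr_sqrtr// sumr_ge0// => i _; exact: sqr_ge0. Qed.

Lemma enorm_ge0 (R : realType) (n : nat) (x : 'rV[R]_n) : 0 <= enorm x.
Proof. exact: sqrtr_ge0. Qed.

Lemma coord_le_enorm (R : realType) (n : nat) (x : 'rV[R]_n) i :
  `|x 0 i| <= enorm x.
Proof.
rewrite -(ler_pXn2r (ltn0Sn 1)) ?nnegrE ?enorm_ge0// enorm_sqr.
rewrite real_normK ?num_real// (bigD1 i)//= lerDl.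
by apply: sumr_ge0 => j _; exact: sqr_ge0.
Qed.

Lemma enorm_gt0 (R : realType) (n : nat) (x : 'rV[R]_n) :
  x != 0 -> 0 < enorm x.
Proof.
move=> x0; rewrite lt_neqAle enorm_ge0 andbT; apply/eqP => e0.
move/eqP: x0; apply; apply/rowP => i; rewrite mxE; apply/eqP.
by rewrite -normr_le0 e0 coord_le_enorm.
Qed.

Lemma enorm0 (R : realType) (n : nat) : enorm (0 : 'rV[R]_n) = 0.
Proof.
by rewrite /enorm big1 ?sqrtr0// => i _; rewrite mxE expr0n.
Qed.

Lemma enormZ (R : realType) (n : nat) (k : R) (x : 'rV[R]_n) :
  enorm (k *: x) = `|k| * enorm x.
Proof.
rewrite /enorm -sqrtr_sqr -sqrtrM ?sqr_ge0// mulr_sumr.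
by congr (Num.sqrt _); apply: eq_bigr => i _; rewrite mxE exprMn.
Qed.

Lemma enorm_le_sum (R : realType) (n : nat) (x : 'rV[R]_n) :
  (forall i, 0 <= x 0 i) -> enorm x <= \sum_i x 0 i.
Proof.
move=> x0; have s0 : 0 <= \sum_i x 0 i by exact: sumr_ge0.
rewrite -(ler_pXn2r (ltn0Sn 1)) ?nnegrE ?enorm_ge0// enorm_sqr.
rewrite [leRHS]expr2 mulr_suml; apply: ler_sum => i _.
rewrite expr2 ler_wpM2l// (bigD1 i)//= lerDl.
exact: sumr_ge0.
Qed.

Lemma continuous_enorm (R : realType) (n : nat) :
  continuous (@enorm R n).
Proof.
move=> x; apply: (@continuous_comp _ _ _
  (fun x : 'rV[R]_n => \sum_i x 0 i ^+ 2) Num.sqrt); last exact: sqrt_continuous.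
apply: (@cvg_sum R _ _ (nbhs x)) => i.
apply: (@continuous_comp _ _ _ (fun x : 'rV[R]_n => x 0 i) (fun y => y ^+ 2)).
  exact: coord_continuous.
exact: exprn_continuous.
Qed.

Lemma compact_enorm_le (R : realType) (n : nat) (r : R) :
  compact [set x : 'rV[R]_n | enorm x <= r].
Proof.
apply: bounded_closed_compact.
  exists r; split; first exact: num_real.
  move=> M rM x /= xr; apply: rV_norm_le => [|i].
    by apply: le_trans (enorm_ge0 x) _; exact: le_trans xr (ltW rM).
  exact: le_trans (coord_le_enorm x i) (le_trans xr (ltW rM)).
apply: (@closed_comp _ _ (@enorm R n) [set y | y <= r]); last exact: closed_le.
by move=> x _; exact: continuous_enorm.
Qed.

Definition usphere (R : realType) (n : nat) : set 'rV[R]_n :=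
  [set x | enorm x = 1].
Arguments usphere : clear implicits.

Lemma compact_usphere (R : realType) (n : nat) : compact (usphere R n).
Proof.
have sub : usphere R n `<=` [set x | enorm x <= 1] by move=> x /= ->.
apply: subclosed_compact (@compact_enorm_le R n 1) sub.
apply: (@closed_comp _ _ (@enorm R n) [set y | y = 1]); last exact: closed_eq.
by move=> x _; exact: continuous_enorm.
Qed.

(** Pairs with p.2 <= p.1 give constant curves, so that sums may run over all pairs
    and still count each coordinate plane once. *)
Definition rotation (R : realType) (n : nat) (p : 'I_n * 'I_n) (s : R)
    (x : 'rV[R]_n) : 'rV[R]_n :=
  if (p.1 < p.2)%N then
    \row_k (if k == p.1 then cos s * x 0 p.1 - sin s * x 0 p.2
            else if k == p.2 then sin s * x 0 p.1 + cos s * x 0 p.2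
            else x 0 k)
  else x.

Lemma rotation0 (R : realType) (n : nat) p (x : 'rV[R]_n) :
  rotation p 0 x = x.
Proof.
rewrite /rotation; case: ifP => // _; apply/rowP => k; rewrite mxE cos0 sin0.
case: eqVneq => [->|_]; first by rewrite mul1r mul0r subr0.
by case: eqVneq => [->|//]; rewrite mul1r mul0r add0r.
Qed.

Lemma enorm_rotation (R : realType) (n : nat) p (s : R) (x : 'rV[R]_n) :
  enorm (rotation p s x) = enorm x.
Proof.
rewrite /rotation; case: ifP => // p12.
have p21 : p.2 != p.1 by rewrite neq_ltn p12 orbT.
congr (Num.sqrt _); rewrite (bigD1 p.1)// (bigD1 p.2)//=.
rewrite [RHS](bigD1 p.1)// [in RHS](bigD1 p.2)//= !mxE eqxx (negbTE p21) eqxx.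
rewrite !addrA; congr (_ + _).
  transitivity ((cos s ^+ 2 + sin s ^+ 2) * (x 0 p.1 ^+ 2 + x 0 p.2 ^+ 2)).
    by ring.
  by rewrite cos2Dsin2 mul1r.
by apply: eq_bigr => k /andP[/negbTE k1 /negbTE k2]; rewrite mxE k1 k2.
Qed.

Lemma rotationZ (R : realType) (n : nat) p (s k : R) (x : 'rV[R]_n) :
  rotation p s (k *: x) = k *: rotation p s x.
Proof.
rewrite /rotation; case: ifP => // _; apply/rowP => i; rewrite !mxE.
case: ifP => _; first by ring.
by case: ifP => _; first by ring.
Qed.

(** * Second derivatives along rotations and dilations *)

Lemma open_neq0 (R : realType) (n : nat) : open [set y : 'rV[R]_n | y != 0].
Proof.
have -> : [set y : 'rV[R]_n | y != 0] = ~` [set 0].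
  by apply/seteqP; split => y /= /eqP.
apply/closed_openC/accessible_closed_set1/hausdorff_accessible.
exact: norm_hausdorff.
Qed.

Lemma Ck_onS (R : realType) (V : normedModType R) (k : nat) (O : set V)
    (f : V -> R) : Ck_on k.+1 O f -> Ck_on k O f.
Proof.
elim: k f => [|k IH] f [cf Df]; first by split.
by split => // v; have [dv Dv] := Df v; split => //; exact: IH.
Qed.

Lemma Ck_on_derivable (R : realType) (V : normedModType R) (k : nat) (O : set V)
    (f : V -> R) (v x : V) : Ck_on k.+1 O f -> O x -> derivable f x v.
Proof. by move=> [_ /(_ v)[+ _]]; exact. Qed.

Lemma Ck_on_derive (R : realType) (V : normedModType R) (k : nat) (O : set V)
    (f : V -> R) (v : V) : Ck_on k.+1 O f -> Ck_on k O ('D_v f).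
Proof. by move=> [_ /(_ v)[_ ]]. Qed.

Lemma Ck_on_is_derive_curve (R : realType) (n : nat) (O : set 'rV[R]_n)
    (f : 'rV[R]_n -> R) (gam : R -> 'rV[R]_n) (s : R) (c : 'I_n -> R) :
  open O -> Ck_on 1 O f -> O (gam s) ->
  (forall i, is_derive s 1 (fun r => gam r 0 i) (c i)) ->
  is_derive s 1 (fun r => f (gam r))
    (\sum_i c i * 'D_(delta_mx 0 i) f (gam s)).
Proof.
move=> oO Cf Os; apply: is_derive_along_curve.
  have : \forall y \near gam s, O y by exact: open_nbhs_nbhs.
  by apply: filterS => y Oy i; exact: Ck_on_derivable Cf Oy.
by move=> i; have [cD _] := Ck_on_derive (delta_mx 0 i) Cf; exact: cD.
Qed.

Definition hess (R : realType) (n : nat) (u : 'rV[R]_n -> R) (x : 'rV[R]_n)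
    (i j : 'I_n) : R :=
  'D_(delta_mx 0 i) ('D_(delta_mx 0 j) u) x.

(** Half of the second derivative of u at x along the rotation in the plane (i, j);
    the other half is obtained by exchanging i and j. *)
Definition rotation_term (R : realType) (n : nat) (u : 'rV[R]_n -> R)
    (x : 'rV[R]_n) (i j : 'I_n) : R :=
  x 0 i ^+ 2 * hess u x j j - x 0 i * x 0 j * hess u x i j
    - x 0 i * grad u x 0 i.

(** The velocity of the rotation is the position turned by a right angle. *)
Lemma is_derive_rotation (R : realType) (n : nat) (p : 'I_n * 'I_n)
    (x : 'rV[R]_n) (s : R) (k : 'I_n) : (p.1 < p.2)%N ->
  is_derive s 1 (fun r => rotation p r x 0 k)
    (if k == p.1 then - rotation p s x 0 p.2
     else if k == p.2 then rotation p s x 0 p.1 else 0).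
Proof.
move=> p12; have p21 : p.2 != p.1 by rewrite neq_ltn p12 orbT.
have -> : (fun r => rotation p r x 0 k) = (fun r =>
   if k == p.1 then cos r * x 0 p.1 - sin r * x 0 p.2
   else if k == p.2 then sin r * x 0 p.1 + cos r * x 0 p.2 else x 0 k).
  by apply/funext => r; rewrite /rotation p12 mxE.
rewrite /rotation p12 !mxE eqxx (negbTE p21) eqxx.
case: ifP => _; last case: ifP => _; last exact: is_derive_cst.
  by apply: is_derive_eq; rewrite /GRing.scale/=; ring.
by apply: is_derive_eq; rewrite /GRing.scale/=; ring.
Qed.

Lemma second_derive_rotation (R : realType) (n : nat) (u : 'rV[R]_n -> R)
    (x : 'rV[R]_n) (p : 'I_n * 'I_n) :
  Ck_on 2 [set y : 'rV[R]_n | y != 0] u -> x != 0 ->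
  second_derive (fun s => u (rotation p s x)) 0
    (if (p.1 < p.2)%N
     then rotation_term u x p.1 p.2 + rotation_term u x p.2 p.1 else 0).
Proof.
move=> Cu x0; case: ifP => p12; last first.
  rewrite (_ : (fun s => _) = fun=> u x); first exact: second_derive_cst.
  by apply/funext => s; rewrite /rotation p12.
have p21 : p.2 != p.1 by rewrite neq_ltn p12 orbT.
have oO := @open_neq0 R n.
have rot0 s : rotation p s x != 0.
  apply/eqP => E; have := enorm_rotation p s x.
  by rewrite E enorm0 => /esym/eqP; rewrite gt_eqF// enorm_gt0.
have sum2 (y d : 'I_n -> R) :
    \sum_k (if k == p.1 then - y p.2 else if k == p.2 then y p.1 else 0) * d k
    = - y p.2 * d p.1 + y p.1 * d p.2.
  rewrite (bigD1 p.1)//= (bigD1 p.2)//= eqxx (negbTE p21) eqxx big1 ?addr0//.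
  by move=> k /andP[/negbTE -> /negbTE ->]; rewrite mul0r.
exists (fun s => - rotation p s x 0 p.2 * 'D_(delta_mx 0 p.1) u (rotation p s x)
     + rotation p s x 0 p.1 * 'D_(delta_mx 0 p.2) u (rotation p s x)).
split=> [s|].
  rewrite -(sum2 (rotation p s x 0) (fun k => 'D_(delta_mx 0 k) u _)).
  apply: (Ck_on_is_derive_curve oO (Ck_onS Cu) (rot0 s)) => i.
  exact: is_derive_rotation.
have d1 := is_derive_rotation x 0 p.1 p12.
have d2 := is_derive_rotation x 0 p.2 p12.
rewrite eqxx in d1; rewrite (negbTE p21) eqxx in d2.
have D j : is_derive (0 : R) 1
    (fun s => 'D_(delta_mx 0 j) u (rotation p s x))
    (- x 0 p.2 * hess u x p.1 j + x 0 p.1 * hess u x p.2 j).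
  rewrite -(sum2 (x 0) (fun k => hess u x k j)).
  have Cj := Ck_on_derive (delta_mx 0 j) Cu.
  have := @Ck_on_is_derive_curve R n _ _ (fun s => rotation p s x) 0
    (fun k => if k == p.1 then - x 0 p.2 else if k == p.2 then x 0 p.1 else 0)
    oO Cj (rot0 0).
  rewrite rotation0; apply => i.
  by have := is_derive_rotation x 0 i p12; rewrite rotation0.
apply: (is_derive_eq (is_deriveD (is_deriveM (is_deriveN d2) (D p.1))
  (is_deriveM d1 (D p.2)))).
rewrite -[(- _) 0]/(- rotation p 0 x 0 p.2) !rotation0 /rotation_term
  /grad !mxE /GRing.scale/=.
move: (hess u x p.1 p.1) (hess u x p.1 p.2) (hess u x p.2 p.1)
  (hess u x p.2 p.2) ('D__ u x) ('D__ u x) (x 0 p.1) (x 0 p.2).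
by move=> *; ring.
Qed.

Lemma is_derive_expRM (R : realType) (k t : R) :
  is_derive t 1 (fun r => expR (k * r)) (k * expR (k * t)).
Proof.
have dk : is_derive t (1 : R) (fun r : R => k * r) k.
  apply: (is_derive_eq (is_deriveZ k (is_derive_id t 1))).
  by rewrite /GRing.scale/= mulr1.
have := @is_derive1_comp R expR (fun r => k * r) t _ k (is_derive_expR _) dk.
by rewrite mulrC.
Qed.

Lemma is_derive_sum_fun (R : realType) (n : nat) (f : 'I_n -> R -> R)
    (df : 'I_n -> R) (t : R) :
  (forall i, is_derive t 1 (f i) (df i)) ->
  is_derive t 1 (fun r => \sum_i f i r) (\sum_i df i).
Proof.
move=> fd; have -> : (fun r => \sum_i f i r) = \sum_i f i.
  by apply/funext => r; rewrite fct_sumE.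
exact: is_derive_sum.
Qed.

Lemma second_derive_radial (R : realType) (n : nat) (u : 'rV[R]_n -> R)
    (th : 'rV[R]_n) (k t : R) :
  Ck_on 2 [set y : 'rV[R]_n | y != 0] u -> th != 0 ->
  second_derive (fun r => expR (k * r) * u (expR r *: th)) t
    (expR (k * t) * (k ^+ 2 * u (expR t *: th)
      + (2 * k + 1) * \sum_i (expR t *: th) 0 i * grad u (expR t *: th) 0 i
      + \sum_i \sum_j (expR t *: th) 0 i * (expR t *: th) 0 j
          * hess u (expR t *: th) i j)).
Proof.
move=> Cu th0.
have oO := @open_neq0 R n.
have g0 r : expR r *: th != 0 by rewrite scaler_eq0 gt_eqF ?expR_gt0.
have dg (r : R) (i : 'I_n) :
    is_derive r 1 (fun r => (expR r *: th) 0 i) ((expR r *: th) 0 i).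
  rewrite mxE (_ : (fun r => _) = fun r => th 0 i * expR r); last first.
    by apply/funext => s; rewrite mxE mulrC.
  by apply: (is_derive_eq (is_deriveZ (th 0 i) (is_derive_expR r)));
    rewrite /GRing.scale/= mulrC.
have du r := Ck_on_is_derive_curve oO (Ck_onS Cu) (g0 r) (dg r).
have dD j r := Ck_on_is_derive_curve oO (Ck_on_derive (delta_mx 0 j) Cu) (g0 r)
  (dg r).
exists (fun r => expR (k * r) * (k * u (expR r *: th) +
  \sum_i (expR r *: th) 0 i * 'D_(delta_mx 0 i) u (expR r *: th))).
split=> [r|].
  apply: (is_derive_eq (is_deriveM (is_derive_expRM k r) (du r))).
  rewrite /GRing.scale/=; move: (\sum_i _) (u _) (expR (k * r)) => *; ring.
have dS := is_derive_sum_fun (fun i => is_deriveM (dg t i) (dD i t)).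
apply: (is_derive_eq (is_deriveM (is_derive_expRM k t)
  (is_deriveD (is_deriveZ k (du t)) dS))).
rewrite /GRing.scale/=.
set y := expR t *: th.
have -> : \sum_i (y 0 i * (\sum_j y 0 j *
      'D_(delta_mx 0 j) ('D_(delta_mx 0 i) u) y) +
    'D_(delta_mx 0 i) u y * y 0 i) =
   \sum_i y 0 i * grad u y 0 i + \sum_i \sum_j y 0 i * y 0 j * hess u y i j.
  rewrite big_split/= addrC; congr (_ + _).
    by apply: eq_bigr => i _; rewrite [grad _ _ _ _]mxE mulrC.
  rewrite exchange_big/=; apply: eq_bigr => i _; rewrite mulr_sumr.
  by apply: eq_bigr => j _; rewrite mulrA (mulrC (y 0 i)).
rewrite -[LHS]/(expR (k * t) * (k * (\sum_i y 0 i * 'D_(delta_mx 0 i) u y)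
  + (\sum_i y 0 i * grad u y 0 i + \sum_i \sum_j y 0 i * y 0 j * hess u y i j))
  + (k * u y + \sum_i y 0 i * 'D_(delta_mx 0 i) u y) * (k * expR (k * t))).
have -> : \sum_i y 0 i * 'D_(delta_mx 0 i) u y = \sum_i y 0 i * grad u y 0 i.
  by apply: eq_bigr => i _; rewrite [grad _ _ _ _]mxE.
move: (\sum_i _) (\sum_i _) (u y) (expR (k * t)) => *; ring.
Qed.

Lemma sum_rotation_pairs (R : realType) (n : nat) (Q : 'I_n -> 'I_n -> R) :
  \sum_(p : 'I_n * 'I_n) (if (p.1 < p.2)%N then Q p.1 p.2 + Q p.2 p.1 else 0)
  = \sum_i \sum_j Q i j - \sum_i Q i i.
Proof.
rewrite -(pair_bigA _ (fun i j : 'I_n =>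
  if (i < j)%N then Q i j + Q j i else 0))/=.
have -> : \sum_(i < n) \sum_(j < n) (if (i < j)%N then Q i j + Q j i else 0) =
   \sum_(i < n) \sum_(j < n) (if (i < j)%N then Q i j else 0)
   + \sum_(i < n) \sum_(j < n) (if (j < i)%N then Q i j else 0).
  rewrite [X in _ = _ + X]exchange_big -big_split/=; apply: eq_bigr => i _.
  rewrite -big_split/=; apply: eq_bigr => j _.
  by case: ifP; rewrite ?addr0.
rewrite -big_split -sumrB/=; apply: eq_bigr => i _.
rewrite -big_split/= [in RHS](bigD1 i)//= addrC addrK.
rewrite (bigD1 i)//= ltnn !add0r; apply: eq_bigr => j ji.
by case: ltngtP => //; rewrite ?addr0 ?add0r// => /val_inj E; rewrite E eqxx in ji.
Qed.

(** The Laplacian of the sphere, |x|^2 Lap - (second derivative along x)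
    - (n - 1) (first derivative along x), in terms of the rotations of coordinate
    planes: the diagonal terms, which correspond to no rotation, are removed. *)
Lemma sum_rotation_term (R : realType) (n : nat) (u : 'rV[R]_n -> R)
    (x : 'rV[R]_n) :
  \sum_i \sum_j rotation_term u x i j - \sum_i rotation_term u x i i
  = enorm x ^+ 2 * (\sum_i hess u x i i)
    - \sum_i \sum_j x 0 i * x 0 j * hess u x i j
    - (n%:R - 1) * \sum_i x 0 i * grad u x 0 i.
Proof.
have -> : \sum_i \sum_j rotation_term u x i j =
   enorm x ^+ 2 * (\sum_i hess u x i i)
    - \sum_i \sum_j x 0 i * x 0 j * hess u x i j
    - n%:R * \sum_i x 0 i * grad u x 0 i.
  rewrite enorm_sqr mulr_suml mulr_sumr -!sumrB; apply: eq_bigr => i _.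
  rewrite mulr_sumr /rotation_term !sumrB; congr (_ - _).
  by rewrite sumr_const card_ord mulr_natl.
have -> : \sum_i rotation_term u x i i = - \sum_i x 0 i * grad u x 0 i.
  rewrite -sumrN; apply: eq_bigr => i _; rewrite /rotation_term.
  by move: (hess u x i i) (grad u x 0 i) (x 0 i) => *; ring.
move: (\sum_i _) (\sum_i _) (\sum_i _) => *; ring.
Qed.

(** * The equation in logarithmic coordinates *)

Lemma is_derive_from_line (R : realType) (V : normedModType R) (f : V -> R)
    (x v : V) (l : R) :
  is_derive (0 : R) 1 (fun s : R => f (x + s *: v)) l -> is_derive x v f l.
Proof.
move=> [fd fE]; have df : derivable f x v.
  by apply/derivable1P; under eq_fun do rewrite addrC.
apply: DeriveDef => //.
have := @is_derive_line R V f x v 0; rewrite scale0r addr0 => /(_ df)[_ <-].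
exact: fE.
Qed.

(** The square of the norm is quadratic along lines, and the power a of the norm is
    the power a / 2 of its square. *)
Lemma is_derive_enorm_powR (R : realType) (n : nat) (x : 'rV[R]_n) (a : R)
    (i : 'I_n) : x != 0 ->
  is_derive x (delta_mx 0 i) (fun y => enorm y `^ a)
    (a * enorm x `^ (a - 2) * x 0 i).
Proof.
move=> x0; have ex := enorm_gt0 x0; apply: is_derive_from_line.
have powE (y : 'rV[R]_n) b : enorm y `^ b = (enorm y ^+ 2) `^ (b / 2).
  by rewrite -powR_mulrn ?enorm_ge0// -powRrM; congr (_ `^ _); field.
pose q (s : R) := enorm x ^+ 2 + s * (2 * x 0 i) + s ^+ 2.
have qE s : enorm (x + s *: delta_mx 0 i) ^+ 2 = q s.
  rewrite /q !enorm_sqr (bigD1 i)//= [in RHS](bigD1 i)//= !mxE !eqxx.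
  set A := \sum_(j | j != i) _; set B := \sum_(j | j != i) _.
  have -> : A = B.
    by apply: eq_bigr => j /negbTE ji; rewrite !mxE ji /= mulr0 addr0.
  by move: B (x 0 i) => *; rewrite mulr1; ring.
rewrite (_ : (fun s => _) = (fun r => r `^ (a / 2)) \o q); last first.
  by apply/funext => s /=; rewrite powE qE.
have dq : is_derive (0 : R) 1 q (2 * x 0 i).
  rewrite /q; apply: is_derive_eq; rewrite /GRing.scale/=.
  by move: (x 0 i) => *; ring.
have q0 : 0 < q 0 by rewrite /q mul0r expr0n/= !addr0 exprn_gt0.
apply: (is_derive_eq (@is_derive1_comp R (fun r : R => r `^ (a / 2)) q 0 _ _
  (is_derive1_powR (a / 2) q0) dq)).
rewrite powE.
have -> : q 0 = enorm x ^+ 2 by rewrite -qE scale0r addr0.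
rewrite (_ : (a - 2) / 2 = a / 2 - 1); last by field.
by move: (_ `^ _) (x 0 i) => *; field.
Qed.

Lemma divergence_weighted_grad (R : realType) (n : nat) (u : 'rV[R]_n -> R)
    (a : R) (x : 'rV[R]_n) :
  Ck_on 2 [set y : 'rV[R]_n | y != 0] u -> x != 0 ->
  divergence (fun y => (enorm y `^ a) *: grad u y) x
  = enorm x `^ (a - 2) * (enorm x ^+ 2 * (\sum_i hess u x i i)
      + a * \sum_i x 0 i * grad u x 0 i).
Proof.
move=> Cu x0; have ex := enorm_gt0 x0.
rewrite mulrDr !mulrA !mulr_sumr -big_split/=; apply: eq_bigr => i _.
rewrite (_ : (fun y => _) = (fun y => enorm y `^ a) * 'D_(delta_mx 0 i) u);
  last by apply/funext => y; rewrite !mxE.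
have dH : is_derive x (delta_mx 0 i) ('D_(delta_mx 0 i) u) (hess u x i i).
  apply: DeriveDef => //; apply: Ck_on_derivable x0.
  exact: Ck_on_derive Cu.
have [_ ->] := is_deriveM (is_derive_enorm_powR a i x0) dH.
rewrite [grad _ _ _ _]mxE /GRing.scale/=.
have -> : enorm x `^ a = enorm x `^ (a - 2) * enorm x ^+ 2.
  rewrite -powR_mulrn ?enorm_ge0// -powRD ?subrK//.
  by apply/implyP => _; rewrite gt_eqF.
move: (hess u x i i) ('D__ u x) (enorm x `^ (a - 2)) (x 0 i) (enorm x) => *.
  by ring.
Qed.

(** The Emden-Fowler transform.  The factor e^(del t / 2) is chosen to cancel the
    first order term in t, which makes the equation invariant under reflections. *)
Definition emden_fowler (R : realType) (n : nat) (del : R) (u : 'rV[R]_n -> R)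
  (t : R) (th : 'rV[R]_n) : R := expR (del / 2 * t) * u (expR t *: th).

(** The second derivatives along dilations and rotations at x = e^t th add up to
    |x|^2 Lap u + a (x . grad u) + (del / 2)^2 u, up to the factor e^(del t / 2): the
    second derivatives along x cancel, and so do the first order terms apart from
    del + 2 - n = a.  The weighted divergence is |x|^(a - 2) times the first
    two terms. *)
Lemma emden_fowler_equation (R : realType) (n : nat) (u : 'rV[R]_n -> R)
    (a f t : R) (th : 'rV[R]_n) :
  let del := n%:R - 2 + a in
  let w := emden_fowler del u in
  Ck_on 2 [set y : 'rV[R]_n | y != 0] u -> usphere R n th ->
  divergence (fun y => (enorm y `^ a) *: grad u y) (expR t *: th) + f = 0 ->
  exists d0 (d : 'I_n * 'I_n -> R),
  [/\ second_derive (fun r => w r th) t d0,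
      forall p, second_derive (fun s => w t (rotation p s th)) 0 (d p) &
      d0 + \sum_p d p
        = (del / 2) ^+ 2 * w t th - expR ((2 - a + del / 2) * t) * f].
Proof.
move=> del w Cu th1 eq.
have th0 : th != 0.
  by apply/eqP => E; move: th1; rewrite /usphere/= E enorm0 => /eqP; rewrite eq_sym oner_eq0.
set x := expR t *: th in eq *.
have x0 : x != 0 by rewrite scaler_eq0 gt_eqF ?expR_gt0.
have ex : enorm x = expR t by rewrite enormZ th1 mulr1 gtr0_norm ?expR_gt0.
exists (expR (del / 2 * t) * ((del / 2) ^+ 2 * u x
  + (2 * (del / 2) + 1) * \sum_i x 0 i * grad u x 0 i
  + \sum_i \sum_j x 0 i * x 0 j * hess u x i j)).
exists (fun p : 'I_n * 'I_n => expR (del / 2 * t) * (if (p.1 < p.2)%N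
     then rotation_term u x p.1 p.2 + rotation_term u x p.2 p.1 else 0)).
split.
- exact: second_derive_radial.
- move=> p; rewrite /w /emden_fowler.
  rewrite (_ : (fun s => _) = fun s => expR (del / 2 * t) * u (rotation p s x)).
    exact/second_deriveZ/second_derive_rotation.
  by apply/funext => s; rewrite rotationZ.
rewrite -mulr_sumr sum_rotation_pairs sum_rotation_term /w /emden_fowler -/x.
move: eq; rewrite divergence_weighted_grad// ex -expRM.
set G := \sum_i x 0 i * grad u x 0 i.
set Hx := \sum_i \sum_j x 0 i * x 0 j * hess u x i j.
set L := \sum_i hess u x i i => eq.
have -> : expR ((2 - a + del / 2) * t) * f =
    - expR (del / 2 * t) * (expR t ^+ 2 * L + a * G).
  have -> : f = - (expR (t * (a - 2)) * (expR t ^+ 2 * L + a * G)).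
    by apply/eqP; rewrite -addr_eq0 addrC eq.
  rewrite mulrN mulrA -expRD mulNr; congr (- (expR _ * _)); ring.
rewrite /del; clear eq; move: G Hx L (u x) (expR t) (expR _) => *.
by field.
Qed.

(** * The nonlinearity on the cylinder *)

Lemma continuous_emden_fowler (R : realType) (n : nat) (del : R)
    (u : 'rV[R]_n -> R) : continuous u ->
  continuous (fun p : R * 'rV[R]_n => emden_fowler del u p.1 p.2).
Proof.
move=> cu p; rewrite /emden_fowler.
have c1 : {for p, continuous (fun p : R * 'rV[R]_n => p.1)} by exact: cvg_fst.
have c2 : {for p, continuous (fun p : R * 'rV[R]_n => p.2)} by exact: cvg_snd.
apply: (@continuousM R (R * 'rV[R]_n)%type (fun p => expR (del / 2 * p.1))
  (fun p => u (expR p.1 *: p.2))).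
  apply: (@continuous_comp _ _ _ (fun p : R * 'rV[R]_n => del / 2 * p.1) expR);
    last exact: continuous_expR.
  by apply: (@continuousM R (R * 'rV[R]_n)%type (fun=> del / 2)) => //; exact: cst_continuous.
apply: (@continuous_comp _ _ _ (fun p : R * 'rV[R]_n => expR p.1 *: p.2) u);
  last exact: cu.
apply: (@continuousZ R 'rV[R]_n (R * 'rV[R]_n)%type (fun p => expR p.1)
  (fun p => p.2)) => //.
by apply: (@continuous_comp _ _ _ fst expR _ c1); exact: continuous_expR.
Qed.

Lemma bounded_on_eball (R : realType) (n : nat) (U : 'rV[R]_n -> 'rV[R]_2)
    (r : R) : (forall i, continuous (fun x => U x 0 i)) ->
  exists M, 0 < M /\ forall i x, enorm x <= r -> U x 0 i <= M.
Proof.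
move=> cU; have [neg|r0] := ltP r 0.
  exists 1; split=> // i x xr; have := enorm_ge0 x.
  by rewrite leNgt (le_lt_trans xr neg).
have [|||i [x [_ xmin]]] := @fin_compact_min R _ [set x : 'rV[R]_n | enorm x <= r]
    (fun i x => - U x 0 i).
- by exists 0; rewrite /= enorm0.
- exact: compact_enorm_le.
- by move=> i p _; apply: continuousN; exact: cU.
exists (`|U x 0 i| + 1); split; first by rewrite ltr_wpDl.
move=> j y yr; have := xmin j y yr; have := ler_norm (U x 0 i); lra.
Qed.

Definition cylinder_nonlinearity (R : realType) (n : nat) (a del : R)
    (F : 'rV[R]_n -> 'rV[R]_2 -> 'rV[R]_2) (i : 'I_2) (t : R) (th : 'rV[R]_n)
    (Y : 'rV[R]_2) : R :=
  expR ((2 - a + del / 2) * t)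
    * F (expR t *: th) (expR (- (del / 2 * t)) *: Y) 0 i.

Lemma usphere_neq0 (R : realType) (n : nat) (t : R) (th : 'rV[R]_n) :
  usphere R n th -> expR t *: th != 0.
Proof.
move=> th1; rewrite scaler_eq0 gt_eqF ?expR_gt0//=.
by apply/eqP => E; move: th1; rewrite /usphere/= E enorm0 => /eqP;
  rewrite eq_sym oner_eq0.
Qed.

Lemma enorm_cylinder (R : realType) (n : nat) (t : R) (th : 'rV[R]_n) :
  usphere R n th -> enorm (expR t *: th) = expR t.
Proof. by move=> th1; rewrite enormZ th1 mulr1 gtr0_norm ?expR_gt0. Qed.

(** Apply the hypothesis at the point e^t th with mu = 1 and
    nu = e^(del (s - t) / 2): then nu^(2 / del) is the dilation from t to s. *)
Lemma cylinder_nonlinearity_increasing (R : realType) (n : nat) (a : R)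
    (F : 'rV[R]_n -> 'rV[R]_2 -> 'rV[R]_2)
    (h_i : forall (x : 'rV[R]_n) (Y : 'rV[R]_2), x != 0 -> open_orthant Y ->
       forall (i : 'I_2) (mu nu : R), 1 <= mu -> mu < nu ->
         mu `^ ((n%:R + 2 - a) / (n%:R - 2 + a))
           * F (mu `^ (2 / (n%:R - 2 + a)) *: x) (mu^-1 *: Y) 0 i
         < nu `^ ((n%:R + 2 - a) / (n%:R - 2 + a))
           * F (nu `^ (2 / (n%:R - 2 + a)) *: x) (nu^-1 *: Y) 0 i)
    (i : 'I_2) (t s : R) (th : 'rV[R]_n) (Y : 'rV[R]_2) :
  0 < n%:R - 2 + a ->
  t < s -> usphere R n th -> open_orthant Y ->
  cylinder_nonlinearity a (n%:R - 2 + a) F i t th Y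
    < cylinder_nonlinearity a (n%:R - 2 + a) F i s th Y.
Proof.
move=> ha ts th1 Yo; set del := n%:R - 2 + a in ha h_i *.
have d0 : del != 0 by rewrite gt_eqF.
pose nu := expR (del / 2 * (s - t)).
have nu1 : 1 < nu by rewrite expR_gt1 mulr_gt0 ?subr_gt0// divr_gt0.
have Yo' : open_orthant (expR (- (del / 2 * t)) *: Y).
  by move=> j; rewrite mxE mulr_gt0 ?expR_gt0//; exact: Yo.
have := h_i _ _ (usphere_neq0 t th1) Yo' i 1 nu (lexx 1) nu1.
rewrite !powR1 invr1 !scale1r mul1r -!expRM scalerA -expRD scalerA -expRN -expRD.
rewrite -(ltr_pM2l (expR_gt0 ((2 - a + del / 2) * t))) mulrA -expRD.
rewrite /cylinder_nonlinearity.
have -> : del / 2 * (s - t) * (2 / del) + t = s by field.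
have -> : - (del / 2 * (s - t)) - del / 2 * t = - (del / 2 * s) by ring.
have -> : (2 - a + del / 2) * t + del / 2 * (s - t) * ((n%:R + 2 - a) / del)
    = (2 - a + del / 2) * s by rewrite /del; field.
by [].
Qed.

(** The scaling inside [cylinder_nonlinearity] undoes the Emden-Fowler transform. *)
Lemma row2_emden_fowler (R : realType) (n : nat) (del t : R)
    (U : 'rV[R]_n -> 'rV[R]_2) (th : 'rV[R]_n) :
  expR (- (del / 2 * t)) *: row2 (fun j => emden_fowler del (fun x => U x 0 j) t th)
  = U (expR t *: th).
Proof.
apply/rowP => j; rewrite !mxE /emden_fowler mulrA -expRD addNr expR0 mul1r.
by [].
Qed.

(** The solution is bounded on the ball of radius e^t1, so its values and those below
    them lie in a compact box, where F is Lipschitz with constant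
    L |x|^b0.  The powers of e^t combine to the exponent
    bet = 2 - a + b0 > 0. *)
Lemma cylinder_nonlinearity_lipschitz (R : realType) (n : nat) (a del : R)
    (F : 'rV[R]_n -> 'rV[R]_2 -> 'rV[R]_2) (U : 'rV[R]_n -> 'rV[R]_2)
    (i : 'I_2) (t1 : R) :
  admissible a F -> (forall j, continuous (fun x => U x 0 j)) ->
  (forall j x, 0 < U x 0 j) ->
  exists L bet : R, [/\ 0 < L, 0 < bet & forall t0, t0 <= t1 ->
    lipschitz_below (usphere R n) (cylinder_nonlinearity a del F)
      (fun j => emden_fowler del (fun x => U x 0 j)) (L * expR (bet * t0)) t0 i].
Proof.
move=> adm cU U0; have [b0 [b0a _ lip]] := adm_lip adm i.
have [M [M0 UM]] := bounded_on_eball (expR t1) cU.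
pose K := [set Y : 'rV[R]_2 | forall j, `[0, M]%classic (Y 0 j)].
have cK : compact K.
  by apply: (@rV_compact _ _ (fun=> `[0, M]%classic)) => _; exact: segment_compact.
have Kor : K `<=` @orthant R.
  by move=> Y KY j; have /= := KY j; rewrite in_itv/= => /andP[].
have [L [L0 lipK]] := lip K cK Kor.
exists L, (2 - a + b0); split => //; first by move: b0a; lra.
move=> t0 t01 t th Y tt0 th1 Yo Yw.
have tt1 := le_trans tt0 t01.
set w := fun j => emden_fowler del (fun x => U x 0 j) t th.
rewrite /cylinder_nonlinearity row2_emden_fowler.
set x := expR t *: th; set c := expR (- (del / 2 * t)).
have c0 : 0 < c by exact: expR_gt0.
have cw j : c * w j = U x 0 j by rewrite -(row2_emden_fowler del t U th) !mxE.
have ex : enorm x = expR t by exact: enorm_cylinder.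
have UxM j : U x 0 j <= M by apply: UM; rewrite ex ler_expR.
have KU : K (U x) by move=> j; rewrite /= in_itv/= ltW//=.
have KY : K (c *: Y).
  move=> j; rewrite /= in_itv/= mxE; apply/andP; split.
    by rewrite mulr_ge0 ?ltW//; exact: Yo.
  by apply: le_trans (UxM j); rewrite -cw ler_pM2l//; exact: Yw.
have := lipK x _ _ (usphere_neq0 t th1) KU KY.
have -> : U x - c *: Y = c *: (row2 w - Y).
  by rewrite scalerBr row2_emden_fowler.
rewrite enormZ (gtr0_norm c0) ex => lipF.
rewrite -mulrBr.
have s1 : enorm (row2 w - Y) <= \sum_j (w j - Y 0 j).
  apply: le_trans (enorm_le_sum _) _ => [j|].
    by rewrite !mxE subr_ge0; exact: Yw.
  by apply: ler_sum => j _; rewrite !mxE.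
have e0 : 0 < expR ((2 - a + del / 2) * t) by exact: expR_gt0.
apply: (@le_trans _ _ (expR ((2 - a + del / 2) * t) *
    (L * expR t `^ b0 * (c * \sum_j (w j - Y 0 j))))).
  rewrite ler_pM2l//; apply: le_trans (ler_norm _) _; apply: le_trans lipF _.
  apply: ler_wpM2l; last by rewrite ler_pM2l.
  by rewrite mulr_ge0 ?powR_ge0// ltW.
apply: (@le_trans _ _ (L * expR ((2 - a + b0) * t) * \sum_j (w j - Y 0 j))).
  rewrite le_eqVlt; apply/orP; left; apply/eqP.
  rewrite -expRM /c.
  have -> : expR ((2 - a + b0) * t) = expR ((2 - a + del / 2) * t)
      * (expR (t * b0) * expR (- (del / 2 * t))).
    by rewrite -!expRD; congr expR; ring.
  by move: (\sum_j _) (expR _) (expR _) (expR _) => *; ring.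
rewrite ler_wpM2r//; first exact: le_trans (enorm_ge0 _) s1.
by rewrite ler_pM2l// ler_expR ler_pM2l//; move: b0a; lra.
Qed.

(** The powers of e^t combine to the exponent
    sig = 2 - a + del / 2 + b - (del / 2) |p|, which is positive exactly when |p| is
    below the critical value (n + 2 + 2 b - a) / del.  As the entries of p exceed 1,
    the monomial Y^p is at least c^(|p| - 1) Y_i when all entries of Y are at least
    c. *)
Lemma cylinder_nonlinearity_growth (R : realType) (n : nat) (a d b r kappa : R)
    (F : 'rV[R]_n -> 'rV[R]_2 -> 'rV[R]_2) (p : 'rV[R]_2) (i : 'I_2) :
  0 < n%:R - 2 + a -> 0 < d -> (forall j, 1 < p 0 j) ->
  \sum_(j < 2) p 0 j < (n%:R + 2 + 2 * b - a) / (n%:R - 2 + a) ->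
  (forall (x : 'rV[R]_n) (Y : 'rV[R]_2), (~` @eball R n r) x -> orthant Y ->
     d * enorm x `^ b * mpow Y p <= F x Y 0 i) ->
  forall c, 0 < c -> exists t0, forall t th (Y : 'rV[R]_2), t0 <= t ->
    usphere R n th -> (forall j, c <= Y 0 j) ->
    kappa * Y 0 i <= cylinder_nonlinearity a (n%:R - 2 + a) F i t th Y.
Proof.
move=> ha d0 p1 psum Fp c c0; set del := n%:R - 2 + a in ha psum *.
pose q := \sum_(j < 2) p 0 j.
pose sig := 2 - a + del / 2 + b - del / 2 * q.
have sig0 : 0 < sig.
  move: psum; rewrite ltr_pdivlMr// -/q /sig /del; lra.
pose D := d * c `^ (q - 1).
have D0 : 0 < D by rewrite mulr_gt0// powR_gt0.
exists (Num.max (ln (Num.max r 1)) (ln (Num.max (kappa / D) 1) / sig)).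
move=> t th Y; rewrite ge_max => /andP[tr tk] th1 cY.
have er : r <= expR t.
  apply: (@le_trans _ _ (Num.max r 1)); first by rewrite le_max lexx.
  by rewrite -ler_ln ?posrE ?expR_gt0 ?lt_max ?ltr01 ?orbT// expRK.
have ek : kappa <= D * expR (sig * t).
  rewrite mulrC -ler_pdivrMr//.
  apply: (@le_trans _ _ (Num.max (kappa / D) 1)); first by rewrite le_max lexx.
  rewrite -ler_ln ?posrE ?expR_gt0 ?lt_max ?ltr01 ?orbT// expRK.
  by rewrite -ler_pdivrMl// mulrC.
have Y0 j : 0 < Y 0 j by exact: lt_le_trans (cY j).
have ex := enorm_cylinder t th1.
have mpowY : c `^ (q - 1) * Y 0 i <= mpow Y p.
  rewrite /mpow /q (bigD1 i)//= [X in _ <= X](bigD1 i)//=.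
  have -> : p 0 i + \sum_(j < 2 | j != i) p 0 j - 1 =
    (p 0 i - 1) + \sum_(j < 2 | j != i) p 0 j by ring.
  rewrite powRD; last by apply/implyP => _; rewrite gt_eqF.
  rewrite mulrAC; apply: ler_pM.
  - by rewrite mulr_ge0 ?powR_ge0 ?ltW.
  - exact: powR_ge0.
  - rewrite -[leRHS](_ : Y 0 i `^ (p 0 i - 1) * Y 0 i = _); last first.
      rewrite -[in X in _ * X](powRr1 (ltW (Y0 i))) -powRD ?subrK//.
      by apply/implyP => _; rewrite gt_eqF.
    rewrite ler_pM2r//.
    apply: ge0_ler_powR; rewrite ?nnegrE ?(ltW (Y0 _)) ?(ltW c0)//.
    by have := p1 i; lra.
  - have powD x y : c `^ (x + y) = c `^ x * c `^ y.
      by rewrite powRD//; apply/implyP => _; rewrite gt_eqF.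
    rewrite (big_morph (fun z => c `^ z) powD (powRr0 c)).
    apply: ler_prod => j _; rewrite powR_ge0/=.
    apply: ge0_ler_powR; rewrite ?nnegrE ?(ltW (Y0 _)) ?(ltW c0)//.
    by have := p1 j; lra.
have Yor : orthant (expR (- (del / 2 * t)) *: Y).
  by move=> j; rewrite mxE mulr_ge0 ?expR_ge0// ltW.
have out : (~` @eball R n r) (expR t *: th).
  by rewrite /eball/= ex; apply/negP; rewrite -leNgt.
have := Fp _ _ out Yor; rewrite ex -expRM => FY.
have mpowZ : mpow (expR (- (del / 2 * t)) *: Y) p
    = expR (- (del / 2 * t) * q) * mpow Y p.
  rewrite /mpow /q mulr_sumr expR_sum -big_split/=; apply: eq_bigr => j _.
  by rewrite mxE powRM ?expR_ge0 ?ltW// -expRM.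
apply: (@le_trans _ _ (D * expR (sig * t) * Y 0 i)); first by rewrite ler_pM2r.
rewrite /cylinder_nonlinearity.
apply: (@le_trans _ _ (expR ((2 - a + del / 2) * t) *
   (d * expR (t * b) * mpow (expR (- (del / 2 * t)) *: Y) p))); last first.
  by rewrite ler_pM2l ?expR_gt0.
rewrite mpowZ /D.
have -> : expR (sig * t) = expR ((2 - a + del / 2) * t)
    * (expR (t * b) * expR (- (del / 2 * t) * q)).
  by rewrite -!expRD; congr expR; rewrite /sig; ring.
have := expR_gt0 ((2 - a + del / 2) * t).
have := expR_gt0 (t * b); have := expR_gt0 (- (del / 2 * t) * q).
move: (expR ((2 - a + del / 2) * t)) (expR (t * b))
  (expR (- (del / 2 * t) * q)) => e3 e2 e1 e1p e2p e3p.
have -> : d * c `^ (q - 1) * (e3 * (e2 * e1)) * Y 0 i =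
   (d * e3 * e2 * e1) * (c `^ (q - 1) * Y 0 i) by ring.
have -> : e3 * (d * e2 * (e1 * mpow Y p)) = (d * e3 * e2 * e1) * mpow Y p by ring.
by rewrite ler_pM2l// !mulr_gt0.
Qed.

(** * Nonexistence *)

Lemma le_expRM (R : realType) (k t c : R) : 0 < k -> 0 < c -> t <= ln c / k ->
  expR (k * t) <= c.
Proof.
by move=> k0 c0; rewrite ler_pdivlMr// mulrC => tc;
  rewrite -[leRHS]lnK ?posrE// ler_expR.
Qed.

(** As U is bounded near the origin, w is at most a multiple of e^(del t / 2) for
    t <= 0. *)
Lemma emden_fowler_decay (R : realType) (n : nat) (del e : R)
    (U : 'rV[R]_n -> 'rV[R]_2) : 0 < del -> 0 < e ->
  (forall i, continuous (fun x => U x 0 i)) ->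
  exists t0, forall i t th, t <= t0 -> usphere R n th ->
    emden_fowler del (fun x => U x 0 i) t th <= e.
Proof.
move=> d0 e0 cU; have [M [M0 UM]] := bounded_on_eball 1 cU.
have d2 : 0 < del / 2 by rewrite divr_gt0.
exists (Num.min 0 (ln (e / M) / (del / 2))) => i t th.
rewrite le_min => /andP[t0 te] th1; rewrite /emden_fowler.
apply: (@le_trans _ _ (expR (del / 2 * t) * M)).
  rewrite ler_pM2l ?expR_gt0//; apply: UM.
  by rewrite enorm_cylinder// -expR0 ler_expR.
by rewrite -ler_pdivlMr//; apply: le_expRM; rewrite ?divr_gt0.
Qed.

Lemma cylinder_system_of_solution (R : realType) (N : nat) (a : R)
    (F : 'rV[R]_N -> 'rV[R]_2 -> 'rV[R]_2) (U : 'rV[R]_N -> 'rV[R]_2) :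
  let del := N%:R - 2 + a in
  0 < del -> admissible a F ->
  (forall i t s th (Y : 'rV[R]_2), t < s -> usphere R N th -> open_orthant Y ->
     cylinder_nonlinearity a del F i t th Y
       < cylinder_nonlinearity a del F i s th Y) ->
  positive_entire_solution a F U ->
  cylinder_system (usphere R N) (@rotation R N) ((del / 2) ^+ 2)
    (cylinder_nonlinearity a del F)
    (fun i => emden_fowler del (fun x => U x 0 i)).
Proof.
move=> del d0 adm incr [U0 cU CU eqU].
have Uw i t th : 0 < emden_fowler del (fun x => U x 0 i) t th.
  by rewrite mulr_gt0 ?expR_gt0.
have sum0 t th (Y : 'rV[R]_2) :
    (forall j, Y 0 j <= emden_fowler del (fun x => U x 0 j) t th) ->
    0 <= \sum_j (emden_fowler del (fun x => U x 0 j) t th - Y 0 j).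
  by move=> Yw; apply: sumr_ge0 => j _; rewrite subr_ge0.
split => //.
- by rewrite exprn_gt0// divr_gt0.
- exact: compact_usphere.
- exact: rotation0.
- by move=> p s th th1; rewrite /usphere/= enorm_rotation.
- by move=> i; exact: continuous_emden_fowler.
- by move=> e e0; exact: emden_fowler_decay.
- move=> i t th Y Z th1 Yo Zo YZ YZi; rewrite /cylinder_nonlinearity.
  rewrite ler_pM2l ?expR_gt0//; apply: (adm_coop adm).
  + exact: usphere_neq0.
  + by move=> j; rewrite mxE mulr_ge0 ?expR_ge0// ltW//; exact: Yo.
  + by move=> j; rewrite mxE mulr_ge0 ?expR_ge0// ltW//; exact: Zo.
  + by move=> j; rewrite !mxE ler_pM2l ?expR_gt0.
  + by rewrite !mxE YZi.
- move=> t1.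
  have lip i : exists l, 0 < l /\ lipschitz_below (usphere R N)
      (cylinder_nonlinearity a del F)
      (fun j => emden_fowler del (fun x => U x 0 j)) l t1 i.
    have [L [bet [L0 bet0 lip]]] :=
      cylinder_nonlinearity_lipschitz del i t1 adm cU U0.
    by exists (L * expR (bet * t1)); split; [rewrite mulr_gt0 ?expR_gt0|exact: lip].
  have [l lP] := choice lip.
  have lpos i : 0 < l i by have [] := lP i.
  exists (\sum_i l i); split.
    by rewrite (bigD1 ord0)//= ltr_pwDl// sumr_ge0// => i _; exact: ltW.
  move=> i t th Y tt1 th1 Yo Yw; have [_ li] := lP i.
  apply: le_trans (li t th Y tt1 th1 Yo Yw) _.
  rewrite ler_wpM2r ?sum0// (bigD1 i)//= lerDl.
  by apply: sumr_ge0 => j _; exact: ltW.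
- move=> l l0.
  have lip i : exists t0, lipschitz_below (usphere R N)
      (cylinder_nonlinearity a del F)
      (fun j => emden_fowler del (fun x => U x 0 j)) l t0 i.
    have [L [bet [L0 bet0 lip]]] :=
      cylinder_nonlinearity_lipschitz del i 0 adm cU U0.
    pose t0 := Num.min 0 (ln (l / L) / bet).
    have t00 : t0 <= 0 by rewrite ge_min lexx.
    exists t0 => t th Y tt0 th1 Yo Yw.
    apply: le_trans (lip t0 t00 t th Y tt0 th1 Yo Yw) _.
    rewrite ler_wpM2r ?sum0// mulrC -ler_pdivlMr//.
    by apply: le_expRM; rewrite ?divr_gt0// ge_min lexx orbT.
  have [t0 t0P] := choice lip.
  exists (- \sum_i `|t0 i|) => i t th Y tt0; apply: t0P.
  apply: le_trans tt0 _; rewrite lerNl (bigD1 i)//=.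
  have := ler_norm (- t0 i); rewrite normrN => h.
  by apply: le_trans h _; rewrite lerDl sumr_ge0.
- move=> i t th th1.
  have := @emden_fowler_equation R N (fun x => U x 0 i) a
    (F (expR t *: th) (U (expR t *: th)) 0 i) t th (CU i) th1
    (eqU i _ (usphere_neq0 t th1)).
  move=> [d [D [Dd DD DE]]]; exists d, D; split => //.
  by rewrite DE /cylinder_nonlinearity row2_emden_fowler.
Qed.

Theorem theorem5 (R : realType) (N : nat) (a : R)
    (F : 'rV[R]_N -> 'rV[R]_2 -> 'rV[R]_2)
    (hN : (3 <= N)%N)
    (ha : 0 < N%:R - 2 + a)
    (hF : admissible a F)
    (h_i : forall (x : 'rV[R]_N) (Y : 'rV[R]_2), x != 0 -> open_orthant Y ->
       forall (i : 'I_2) (mu nu : R), 1 <= mu -> mu < nu ->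
         mu `^ ((N%:R + 2 - a) / (N%:R - 2 + a))
           * F (mu `^ (2 / (N%:R - 2 + a)) *: x) (mu^-1 *: Y) 0 i
         < nu `^ ((N%:R + 2 - a) / (N%:R - 2 + a))
           * F (nu `^ (2 / (N%:R - 2 + a)) *: x) (nu^-1 *: Y) 0 i)
    (h_ii : exists (d b : R) (P : 'I_2 -> 'rV[R]_2),
       [/\ 0 < d,
           b > a - 2,
           (forall i j : 'I_2, 1 < P i 0 j),
           (forall i : 'I_2, \sum_(j < 2) P i 0 j
              < (N%:R + 2 + 2 * b - a) / (N%:R - 2 + a)) &
           \forall r \near +oo, 1 < r ->
             forall (i : 'I_2) (x : 'rV[R]_N) (Y : 'rV[R]_2),
               (~` @eball R N r) x -> orthant Y ->
               d * enorm x `^ b * mpow Y (P i) <= F x Y 0 i]) :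
  ~ exists U : 'rV[R]_N -> 'rV[R]_2, positive_entire_solution a F U.
Proof.
move=> [U solU].
have cs := cylinder_system_of_solution ha hF
  (fun i t s th Y => @cylinder_nonlinearity_increasing R N a F h_i i t s th Y ha)
  solU.
have [d [b [P [d0 _ P1 Psum nearF]]]] := h_ii.
have [r [r1 Fr]] : exists r : R, 1 < r /\
    forall (i : 'I_2) (x : 'rV[R]_N) (Y : 'rV[R]_2),
      (~` @eball R N r) x -> orthant Y ->
      d * enorm x `^ b * mpow Y (P i) <= F x Y 0 i.
  have [A [Ar AP]] := nearF; exists (Num.max A 1 + 1).
  have A1 : A <= Num.max A 1 by rewrite le_max lexx.
  have h1 : 1 <= Num.max A 1 by rewrite le_max lexx orbT.
  have r1 : 1 < Num.max A 1 + 1 by lra.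
  by split => //; apply: AP => //; lra.
apply: (cylinder_no_solution (i := ord0) cs).
  exists (delta_mx 0 (Ordinal (ltnW (ltnW hN)))).
  rewrite /usphere/= /enorm (bigD1 (Ordinal (ltnW (ltnW hN))))//= big1.
    by rewrite mxE !eqxx expr1n addr0 sqrtr1.
  by move=> j /negbTE jn; rewrite mxE jn andbF expr0n.
exact: (@cylinder_nonlinearity_growth R N a d b r
  (((N%:R - 2 + a) / 2) ^+ 2 + 2) F (P ord0) ord0 ha d0 (P1 ord0) (Psum ord0)
  (Fr ord0)).
Qed.
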